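(* Let $R$ be a real closed field, let $d \geq 0$, let $a_0,\ldots,a_d \in R$, let $f = \sum_{i=0}^d a_i \sigma_i \in \Lambda$ be a linear combination of the elementary symmetric functions, and let $I = (f) \subset \Lambda$ be the ideal generated by $f$. Then for any partition $\lambda$ and all $n$ large enough, the multiplicity $m_{0,\{\lambda\}_n}(V_n(I))$ equals $0$ if $\mathrm{length}(\lambda) > 0$, and it stabilizes to a (possibly non-zero) constant, independent of $n$, if $\mathrm{length}(\lambda) = 0$ (i.e. when $\lambda$ is the empty partition).
   Context: Let $\Lambda_n = R[X_1,\ldots,X_n]^{\mathfrak{S}_n}$ be the graded ring of symmetric polynomials, with graded homomorphisms $\Lambda_{n+m} \to \Lambda_n$ given by setting $X_{n+1},\ldots,X_{n+m}$ to $0$. Let $\Lambda = \varprojlim \Lambda_n$ (limit in the category of graded rings) and let $\phi_n : \Lambda \to \Lambda_n$ be the induced graded homomorphisms. The element $\sigma_\ell \in \Lambda$ is the one with $\phi_n(\sigma_\ell) = \sigma_{\ell,n}$ for all $n$, where $\sigma_{\ell,n}$ is the $\ell$-th elementary symmetric polynomial in $X_1,\ldots,X_n$ ($\sigma_{0,n}=1$ and $\sigma_{\ell,n}=0$ for $\ell>n$). For a finitely generated ideal $I = (f_1,\ldots,f_k) \subset \Lambda$ and $n > 0$, $V_n(I) \subset R^n$ is the set of common zeros in $R^n$ of $\phi_n(f_1),\ldots,\phi_n(f_k)$; it is stable under the action of $\mathfrak{S}_n$ permuting coordinates. For a closed semi-algebraic set $S \subset R^n$ stable under the permutation action of $\mathfrak{S}_n$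 (a symmetric set), $H^i(S)$ denotes the $i$-th cohomology with rational coefficients, with the induced structure of a finite dimensional $\mathfrak{S}_n$-module over $\mathbb{Q}$. For a partition $\mu \vdash n$, $\mathbb{S}^\mu$ denotes the corresponding Specht module (the irreducible $\mathfrak{S}_n$-module indexed by $\mu$; $\mathbb{S}^{(n)}$ is the trivial representation), and $m_{i,\mu}(S)$ denotes the multiplicity of $\mathbb{S}^\mu$ in $H^i(S)$, so that $H^i(S) \cong \bigoplus_{\mu \vdash n} m_{i,\mu}(S)\, \mathbb{S}^\mu$. For a partition $\lambda = (\lambda_1,\ldots,\lambda_\ell)$ of an integer $e$ and $n \geq \lambda_1 + e$, $\{\lambda\}_n = (n-e,\lambda_1,\ldots,\lambda_\ell) \vdash n$. For the empty partition $\lambda$, $\{\lambda\}_n = (n)$. The length of a partition is its number of (non-zero) parts. *)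

(* Defs.v *)
From HB Require Import structures.
From mathcomp Require Import all_boot all_order all_algebra all_fingroup.
From mathcomp Require Import mpoly.
From mathcomp Require Import boolp classical_sets functions.

Set Implicit Arguments.
Unset Strict Implicit.
Unset Printing Implicit Defensive.

Import Order.TTheory GRing.Theory Num.Theory.

Local Open Scope ring_scope.
Local Open Scope classical_set_scope.

(* Substitution of 0 for the last m of n + m variables. *)
Definition restrX (R : rcfType) (n m : nat) (i : 'I_(n + m)) : {mpoly R[n]} :=
  if fintype.split i is inl j then 'X_j else 0.

Definition restr (R : rcfType) (n m : nat) (p : {mpoly R[n + m]}) :
    {mpoly R[n]} :=
  p \mPo [tuple restrX R i | i < n + m].

(* An element of the limit, in graded rings, of the rings of symmetric
   polynomials: a compatible family of symmetric polynomials of bounded degree.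
   The bound is what distinguishes the limit of graded rings, i.e. the direct
   sum of the limits of the homogeneous parts, from the limit of rings. *)
Record Lambda (R : rcfType) := MkLambda {
  phi : forall n, {mpoly R[n]};
  phi_sym : forall n, phi n \is symmetric;
  phi_restr : forall n m, restr (phi (n + m)) = phi n;
  phi_bounded : exists D : nat, forall n, (msize (phi n) <= D)%N
}.

Section LambdaRing.
Variable R : rcfType.
Implicit Types f g h : Lambda R.

HB.instance Definition _ := gen_eqMixin (Lambda R).
HB.instance Definition _ := gen_choiceMixin (Lambda R).

Lemma LambdaP f g : (forall n, phi f n = phi g n) -> f = g.
Proof.
case: f g => [f f1 f2 f3] [g g1 g2 g3] /= fg.
have {}fg : f = g by apply: functional_extensionality_dep.
by case: _ / fg in g1 g2 g3 *; congr MkLambda; exact: Prop_irrelevance.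
Qed.

Program Definition Lambda0 := @MkLambda R (fun _ => 0) _ _ _.
Next Obligation. exact: rpred0. Qed.
Next Obligation. by rewrite /restr raddf0. Qed.
Next Obligation. by exists 0%N => n; rewrite msize0. Qed.

Program Definition Lambda1 := @MkLambda R (fun _ => 1) _ _ _.
Next Obligation. exact: rpred1. Qed.
Next Obligation. by rewrite /restr rmorph1. Qed.
Next Obligation. by exists 1%N => n; rewrite msize1. Qed.

Program Definition Lambda_opp f := @MkLambda R (fun n => - phi f n) _ _ _.
Next Obligation. by rewrite rpredN phi_sym. Qed.
Next Obligation.
by rewrite -[in RHS](phi_restr f n m); exact: raddfN.
Qed.
Next Obligation.
by have [D fD] := phi_bounded f; exists D => n; rewrite msizeN.
Qed.

Program Definition Lambda_add f g :=
  @MkLambda R (fun n => phi f n + phi g n) _ _ _.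
Next Obligation. by rewrite rpredD ?phi_sym. Qed.
Next Obligation.
by rewrite -[in RHS](phi_restr f n m) -[in RHS](phi_restr g n m); exact: raddfD.
Qed.
Next Obligation.
have [D fD] := phi_bounded f; have [E gE] := phi_bounded g.
exists (maxn D E) => n; apply: leq_trans (msizeD_le _ _) _.
by rewrite geq_max !leq_max fD gE orbT.
Qed.

Program Definition Lambda_mul f g :=
  @MkLambda R (fun n => phi f n * phi g n) _ _ _.
Next Obligation. by rewrite rpredM ?phi_sym. Qed.
Next Obligation.
by rewrite -[in RHS](phi_restr f n m) -[in RHS](phi_restr g n m); exact: rmorphM.
Qed.
Next Obligation.
have [D fD] := phi_bounded f; have [E gE] := phi_bounded g.
exists (D + E).+1 => n; apply: leq_trans (msizeM_le _ _) _.
by rewrite ltnS leq_add.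
Qed.

Program Definition Lambda_scale (c : R) f :=
  @MkLambda R (fun n => c *: phi f n) _ _ _.
Next Obligation. by rewrite rpredZ ?phi_sym. Qed.
Next Obligation.
by rewrite -[in RHS](phi_restr f n m); exact: linearZ.
Qed.
Next Obligation.
have [D fD] := phi_bounded f; exists D => n.
exact: leq_trans (msizeZ_le _ _) _.
Qed.

Fact Lambda_addA : associative Lambda_add.
Proof. by move=> f g h; apply: LambdaP => n /=; rewrite addrA. Qed.
Fact Lambda_addC : commutative Lambda_add.
Proof. by move=> f g; apply: LambdaP => n /=; rewrite addrC. Qed.
Fact Lambda_add0 : left_id Lambda0 Lambda_add.
Proof. by move=> f; apply: LambdaP => n /=; rewrite add0r. Qed.
Fact Lambda_addN : left_inverse Lambda0 Lambda_opp Lambda_add.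
Proof. by move=> f; apply: LambdaP => n /=; rewrite addNr. Qed.
HB.instance Definition _ := GRing.isZmodule.Build (Lambda R)
  Lambda_addA Lambda_addC Lambda_add0 Lambda_addN.

Fact Lambda_mulA : associative Lambda_mul.
Proof. by move=> f g h; apply: LambdaP => n /=; rewrite mulrA. Qed.
Fact Lambda_mulC : commutative Lambda_mul.
Proof. by move=> f g; apply: LambdaP => n /=; rewrite mulrC. Qed.
Fact Lambda_mul1 : left_id Lambda1 Lambda_mul.
Proof. by move=> f; apply: LambdaP => n /=; rewrite mul1r. Qed.
Fact Lambda_mulD : left_distributive Lambda_mul Lambda_add.
Proof. by move=> f g h; apply: LambdaP => n /=; rewrite mulrDl. Qed.
Fact Lambda_1neq0 : Lambda1 != 0 :> Lambda R.
Proof.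
apply/eqP => /(congr1 (fun f : Lambda R => phi f 0)) /= /eqP.
by rewrite oner_eq0.
Qed.
HB.instance Definition _ := GRing.Zmodule_isComNzRing.Build (Lambda R)
  Lambda_mulA Lambda_mulC Lambda_mul1 Lambda_mulD Lambda_1neq0.

Fact Lambda_scaleA a b f :
  Lambda_scale a (Lambda_scale b f) = Lambda_scale (a * b) f.
Proof. by apply: LambdaP => n /=; rewrite scalerA. Qed.
Fact Lambda_scale1 : left_id 1 Lambda_scale.
Proof. by move=> f; apply: LambdaP => n /=; rewrite scale1r. Qed.
Fact Lambda_scaleDr : right_distributive Lambda_scale +%R.
Proof. by move=> a f g; apply: LambdaP => n /=; rewrite scalerDr. Qed.
Fact Lambda_scaleDl f : {morph Lambda_scale^~ f : a b / a + b}.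
Proof. by move=> a b; apply: LambdaP => n /=; rewrite scalerDl. Qed.
HB.instance Definition _ := GRing.Zmodule_isLmodule.Build R (Lambda R)
  Lambda_scaleA Lambda_scale1 Lambda_scaleDr Lambda_scaleDl.

End LambdaRing.

Lemma restr_mesym (R : rcfType) n m k :
  restr (mesym (n + m) R k) = mesym n R k.
Proof.
have prodE (h : {set 'I_(n + m)}) :
    restr (\prod_(i in h) 'X_i) = \prod_(i in h) restrX R i.
  rewrite /restr rmorph_prod; apply: eq_bigr => i _ /=.
  by rewrite comp_mpolyXU -tnth_nth tnth_mktuple.
have -> : restr (mesym (n + m) R k) =
    \sum_(h : {set 'I_(n + m)} | #|h| == k) \prod_(i in h) restrX R i.
  by rewrite /restr raddf_sum /=; apply: eq_bigr => h _; exact: prodE.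
have lsh_inj : injective (@lshift n m) by exact: lshift_inj.
rewrite (bigID (fun h : {set 'I_(n + m)} =>
                  h \subset lshift m @: [set: 'I_n]%SET)) /=.
rewrite [X in _ + X]big1 ?addr0; first last.
  move=> h /andP[_ /fintype.subsetPn[i ih il]]; rewrite (bigD1 i) //= /restrX.
  case: fintype.splitP => [j ij|j _]; last by rewrite mul0r.
  case/negP: il; apply/imsetP; exists j; [by rewrite inE|exact: ord_inj].
pose ext (g : {set 'I_n}) : {set 'I_(n + m)} := (lshift m @: g)%SET.
pose cut (h : {set 'I_(n + m)}) : {set 'I_n} := (lshift m @^-1: h)%SET.
rewrite (reindex_onto ext cut) /=; last first.
  move=> h /andP[_ /fintype.subsetP hl]; apply/setP => i; apply/imsetP/idP.
    by case=> j; rewrite inE => jh ->.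
  by move=> ih; have /imsetP[j _ ij] := hl i ih; exists j; rewrite // inE -ij.
apply: eq_big => [g|g _].
  rewrite card_imset // imsetS ?finset.subsetT // andbT.
  rewrite [X in _ && X](_ : _ = true) ?andbT //.
  by apply/eqP/setP => j; rewrite inE mem_imset.
rewrite big_imset /=; last by move=> i j _ _; apply: lsh_inj.
by apply: eq_bigr => j _; rewrite /restrX (unsplitK (inl _ j)).
Qed.

Program Definition sigma (R : rcfType) (l : nat) : Lambda R :=
  @MkLambda R (fun n => mesym n R l) _ _ _.
Next Obligation. by exact: mesym_sym. Qed.
Next Obligation. by exact: restr_mesym. Qed.
Next Obligation.
exists l.+1 => n; rewrite msizeE; apply/bigmax_leqP_seq => m ms _.
by rewrite (dhomog_mf (dhomog_mesym _ _ _) ms).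
Qed.

Definition ideal_gen (R : rcfType) (fs : seq (Lambda R)) : set (Lambda R) :=
  [set g | exists c : 'I_(size fs) -> Lambda R,
             g = \sum_(i < size fs) c i * fs`_i].

(* [col_perm s x] has coordinates x_(s i).  Since (s * t) i = t (s i) in
   MathComp, this is a left action of 'S_n on R^n. *)
Record symset (R : rcfType) (n : nat) := SymSet {
  symset_set :> set 'rV[R]_n;
  symset_perm : forall (s : 'S_n) x, symset_set x -> symset_set (col_perm s x)
}.

Lemma meval_msym (R : rcfType) n (s : 'S_n) (p : {mpoly R[n]}) (v : 'I_n -> R) :
  (msym s p).@[v] = p.@[fun i => v (s i)].
Proof.
rewrite [in LHS](mpolyE p) [in RHS](mpolyE p) (raddf_sum (msym s)) !(raddf_sum (meval _)) /=.
apply: eq_bigr => m _; rewrite msymZ !mevalZ msymX !mevalX.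
congr (_ * _); rewrite (reindex_inj (@perm_inj _ s)) /=.
by apply: eq_bigr => i _; rewrite mnmE permK.
Qed.

Definition V_set (R : rcfType) (n : nat) (I : set (Lambda R)) : set 'rV[R]_n :=
  [set x | forall g, I g -> (phi g n).@[x 0] = 0].

Lemma V_set_perm (R : rcfType) n (I : set (Lambda R)) (s : 'S_n) x :
  V_set I x -> V_set I (col_perm s x).
Proof.
move=> Vx g Ig; rewrite -[RHS](Vx g Ig).
have sg : msym s (phi g n) = phi g n by move/issymP: (phi_sym g n); exact.
rewrite -[in RHS]sg meval_msym.
by apply: meval_eq => i; rewrite mxE.
Qed.

Definition V (R : rcfType) (n : nat) (I : set (Lambda R)) : symset R n :=
  SymSet (@V_set_perm R n I).

(* The zero set above is taken over the whole ideal; the generators suffice. *)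
Lemma V_ideal_gen (R : rcfType) n (fs : seq (Lambda R)) (x : 'rV[R]_n) :
  V_set (ideal_gen fs) x <-> forall f, f \in fs -> (phi f n).@[x 0] = 0.
Proof.
have phi_sum k (F : 'I_k -> Lambda R) :
    phi (\sum_(i < k) F i) n = \sum_(i < k) phi (F i) n.
  by apply: (big_morph (fun g : Lambda R => phi g n)).
split=> [Vx f ffs|fs0 _ [c ->]].
  have fi : (index f fs < size fs)%N by rewrite index_mem.
  apply: Vx; exists (fun i => (i == Ordinal fi)%:R).
  rewrite (bigD1 (Ordinal fi)) //= eqxx mul1r nth_index // big1 ?addr0 //.
  by move=> i /negPf ->; rewrite mul0r.
rewrite phi_sum raddf_sum big1 // => i _.
have := fs0 fs`_i (mem_nth 0 (ltn_ord i)).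
by rewrite /= mevalM => ->; rewrite mulr0.
Qed.

Record snModule (n : nat) := SnModule {
  snm_sort :> lmodType rat;
  snm_act : 'S_n -> snm_sort -> snm_sort;
  snm_linear : forall s, linear (snm_act s);
  snm_act1 : forall v, snm_act 1 v = v;
  snm_actM : forall s t v, snm_act (s * t) v = snm_act s (snm_act t v)
}.

Definition snm_iso n (M N : snModule n) : Prop :=
  exists f : {linear M -> N},
    bijective f /\ forall s v, f (snm_act s v) = snm_act s (f v).

Record snSubmodule n (M : snModule n) := SnSubmodule {
  sns_mem :> {pred M};
  sns_mem0 : 0 \in sns_mem;
  sns_memP : forall a u v,
    u \in sns_mem -> v \in sns_mem -> a *: u + v \in sns_mem;
  sns_act : forall s v, v \in sns_mem -> snm_act s v \in sns_mem
}.

Section SubQuotient.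
Variables (n : nat) (M : snModule n) (N : snSubmodule M).

Fact sns_submod_closed : submod_closed (sns_mem N).
Proof.
by split=> [|a u v]; [exact: sns_mem0 | exact: sns_memP].
Qed.
HB.instance Definition _ :=
  GRing.isSubmodClosed.Build rat M (sns_mem N) sns_submod_closed.

Record sub_sort := SubSort { sub_val :> M; sub_valP : sub_val \in sns_mem N }.
HB.instance Definition _ := [isSub for sub_val].
HB.instance Definition _ := [Choice of sub_sort by <:].
HB.instance Definition _ := [SubChoice_isSubLmodule of sub_sort by <:].

Definition sub_act (s : 'S_n) (v : sub_sort) : sub_sort :=
  SubSort (sns_act s (sub_valP v)).

Fact sub_linear s : linear (sub_act s).
Proof. by move=> a u v; apply: val_inj; rewrite /= snm_linear. Qed.
Fact sub_act1 v : sub_act 1 v = v.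
Proof. by apply: val_inj; rewrite /= snm_act1. Qed.
Fact sub_actM s t v : sub_act (s * t) v = sub_act s (sub_act t v).
Proof. by apply: val_inj; rewrite /= snm_actM. Qed.

Definition subSnModule : snModule n := SnModule sub_linear sub_act1 sub_actM.

Definition quot_sort := Quotient.quot [the zmodClosed M of sns_mem N].
HB.instance Definition _ := GRing.Zmodule.on quot_sort.

Local Notation pi := (\pi_quot_sort)%qT.
Local Notation repr := generic_quotient.repr.

Lemma quot_eqP (u v : M) : pi u = pi v <-> u - v \in sns_mem N.
Proof.
by rewrite (Quotient.idealrBE [the zmodClosed M of sns_mem N]); split=> /eqP.
Qed.

Definition quot_scale (a : rat) (x : quot_sort) : quot_sort := pi (a *: repr x).
Definition quot_act (s : 'S_n) (x : quot_sort) : quot_sort :=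
  pi (snm_act s (repr x)).

Lemma quot_piD u v : pi (u + v) = pi u + pi v.
Proof. exact: Quotient.pi_add. Qed.

Lemma quot_piZ a u : pi (a *: u) = quot_scale a (pi u).
Proof.
apply/quot_eqP; rewrite -scalerBr rpredZ //; apply/quot_eqP.
by rewrite reprK.
Qed.

Lemma snm_actB s (u v : M) : snm_act s (u - v) = snm_act s u - snm_act s v.
Proof. by rewrite addrC -scaleN1r snm_linear scaleN1r addrC. Qed.

Lemma quot_pi_act s u : pi (snm_act s u) = quot_act s (pi u).
Proof.
apply/quot_eqP; rewrite -snm_actB sns_act //; apply/quot_eqP.
by rewrite reprK.
Qed.

Fact quot_scaleA a b x : quot_scale a (quot_scale b x) = quot_scale (a * b) x.
Proof.
by rewrite -[x]reprK -(quot_piZ b) -(quot_piZ a) -(quot_piZ (a * b)) scalerA.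
Qed.
Fact quot_scale1 : left_id 1 quot_scale.
Proof. by move=> x; rewrite -[x]reprK -(quot_piZ 1) scale1r. Qed.
Fact quot_scaleDr : right_distributive quot_scale +%R.
Proof.
move=> a x y; rewrite -[x]reprK -[y]reprK.
rewrite -(quot_piD (repr x)) -(quot_piZ a (_ + _)) scalerDr quot_piD.
by rewrite (quot_piZ a (repr x)) (quot_piZ a (repr y)).
Qed.
Fact quot_scaleDl x : {morph quot_scale^~ x : a b / a + b}.
Proof.
move=> a b /=; rewrite -[x]reprK -(quot_piZ (a + b)) scalerDl quot_piD.
by rewrite (quot_piZ a (repr x)) (quot_piZ b (repr x)).
Qed.
HB.instance Definition _ := GRing.Zmodule_isLmodule.Build rat quot_sort
  quot_scaleA quot_scale1 quot_scaleDr quot_scaleDl.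

Fact quot_linear s : linear (quot_act s).
Proof.
move=> a x y; rewrite -[x]reprK -[y]reprK.
have -> : a *: (pi (repr x) : quot_sort) + pi (repr y) =
          pi (a *: repr x + repr y).
  by rewrite quot_piD (quot_piZ a (repr x)).
rewrite -(quot_pi_act s (_ + _)) snm_linear quot_piD (quot_piZ a (snm_act s _)).
by rewrite (quot_pi_act s (repr x)) (quot_pi_act s (repr y)).
Qed.
Fact quot_act1 x : quot_act 1 x = x.
Proof. by rewrite -[x]reprK -(quot_pi_act 1) snm_act1. Qed.
Fact quot_actM s t x : quot_act (s * t) x = quot_act s (quot_act t x).
Proof.
rewrite -[x]reprK -(quot_pi_act t) -(quot_pi_act s) -(quot_pi_act (s * t)%g).
by rewrite snm_actM.
Qed.

Definition quotSnModule : snModule n :=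
  SnModule quot_linear quot_act1 quot_actM.

End SubQuotient.

(* The equation p = 0 is covered as ~ (0 < p) /\ ~ (0 < - p). *)
Inductive semialgebraic (R : rcfType) (n : nat) : set 'rV[R]_n -> Prop :=
| sa_pos (p : {mpoly R[n]}) : semialgebraic [set x | 0 < p.@[x 0]]
| sa_compl A : semialgebraic A -> semialgebraic (~` A)
| sa_union A B : semialgebraic A -> semialgebraic B -> semialgebraic (A `|` B).

Lemma sa_ext (R : rcfType) (n : nat) (A B : set 'rV[R]_n) :
  A = B -> semialgebraic A -> semialgebraic B.
Proof. by move=> ->. Qed.

Lemma sa_preimage (R : rcfType) (n m : nat) (q : 'I_n -> {mpoly R[m]})
    (A : set 'rV[R]_n) :
  semialgebraic A ->
  semialgebraic [set x : 'rV_m | A (\row_i (q i).@[x 0])].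
Proof.
elim=> {A} [p|A _ saA|A B _ saA _ saB].
- apply: sa_ext (sa_pos (p \mPo [tuple q i | i < n])).
  apply/funext => x /=; congr (is_true (0 < _)).
  rewrite comp_mpoly_meval; apply: meval_eq => i.
  by rewrite mxE tnth_mktuple.
- exact: sa_compl.
- exact: sa_union.
Qed.

Definition is_simplex_point (R : rcfType) p (t : 'rV[R]_p.+1) : bool :=
  [forall i, 0 <= t 0 i] && (\sum_i t 0 i == 1).

Definition stdsimplex (R : rcfType) p : Type :=
  {t : 'rV[R]_p.+1 | is_simplex_point t}.

Definition face_coord (R : rcfType) p (i : 'I_p.+2) (t : 'rV[R]_p.+1) :
    'rV[R]_p.+2 :=
  \row_j (if unlift i j is Some k then t 0 k else 0).

Fact face_coordP (R : rcfType) p (i : 'I_p.+2) (t : 'rV[R]_p.+1) :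
  is_simplex_point t -> is_simplex_point (face_coord i t).
Proof.
case/andP=> /forallP t0 /eqP t1; apply/andP; split.
  by apply/forallP => j; rewrite mxE; case: unliftP.
rewrite (bigD1_ord i) //= mxE unlift_none add0r -[X in _ == X]t1; apply/eqP.
by apply: eq_bigr => j _; rewrite mxE liftK.
Qed.

Definition face (R : rcfType) p (i : 'I_p.+2) (t : stdsimplex R p) :
    stdsimplex R p.+1 :=
  exist _ (face_coord i (val t)) (face_coordP i (valP t)).

Definition continuous_simplex (R : rcfType) n p
    (f : stdsimplex R p -> 'rV[R]_n) : Prop :=
  forall (t : stdsimplex R p) (e : R), 0 < e ->
    exists2 d : R, 0 < d & forall u : stdsimplex R p,
      (forall i, `|val u 0 i - val t 0 i| < d) ->
      forall j, `|f u 0 j - f t 0 j| < e.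

Definition graph_simplex (R : rcfType) n p (f : stdsimplex R p -> 'rV[R]_n) :
    set 'rV[R]_(p.+1 + n) :=
  range (fun t => row_mx (val t) (f t)).

Record simplex (R : rcfType) n (S : set 'rV[R]_n) (p : nat) := Simplex {
  simplex_fun :> stdsimplex R p -> 'rV[R]_n;
  simplex_in : forall t, S (simplex_fun t);
  simplex_continuous : continuous_simplex simplex_fun;
  simplex_sa : semialgebraic (graph_simplex simplex_fun)
}.

Lemma simplexP (R : rcfType) n (S : set 'rV[R]_n) p (f g : simplex S p) :
  (forall t, f t = g t) -> f = g.
Proof.
case: f g => [f f1 f2 f3] [g g1 g2 g3] /= fg.
have {}fg : f = g by apply/funext.
by case: _ / fg in g1 g2 g3 *; congr Simplex; exact: Prop_irrelevance.
Qed.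

Section Faces.
Variables (R : rcfType) (n : nat) (S : set 'rV[R]_n) (p : nat).
Variables (i : 'I_p.+2) (f : simplex S p.+1).

Fact face_in t : S (f (face i t)). Proof. exact: simplex_in. Qed.

Fact face_continuous : continuous_simplex (fun t => f (face i t)).
Proof.
move=> t e e0; have [d d0 fd] := simplex_continuous f (face i t) e0.
exists d => // u ut; apply: fd => j; rewrite /= !mxE.
by case: unliftP => [k _|_]; rewrite ?ut // subrr normr0.
Qed.

Fact face_sa : semialgebraic (graph_simplex (fun t => f (face i t))).
Proof.
pose tX k : {mpoly R[p.+1 + n]} := 'X_(lshift n k).
pose q (j : 'I_(p.+2 + n)) : {mpoly R[p.+1 + n]} :=
  match fintype.split j with
  | inl j => if unlift i j is Some k then tX k else 0
  | inr j => 'X_(rshift p.+1 j)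
  end.
have qE (x : 'rV[R]_(p.+1 + n)) :
    \row_j (q j).@[x 0] = row_mx (face_coord i (lsubmx x)) (rsubmx x).
  apply/rowP => j; rewrite mxE /q mxE; case: fintype.splitP => k _.
    rewrite mxE; case: unliftP => [l _|_]; last by rewrite meval0.
    by rewrite mevalXU mxE.
  by rewrite mevalXU mxE.
apply: sa_ext (sa_preimage q (simplex_sa f)); apply/esym.
apply/seteqP; split=> [_ [t _ <-]|x] /=.
  rewrite qE row_mxKl row_mxKr; exists (face i t) => //.
case=> t _; rewrite qE => /eq_row_mx[tx fx].
have ux : is_simplex_point (lsubmx x).
  have := valP t; rewrite tx => /andP[/forallP u0 /eqP u1].
  apply/andP; split.
    by apply/forallP => k; have := u0 (lift i k); rewrite mxE liftK.
  move: u1; rewrite (bigD1_ord i) //= mxE unlift_none add0r => <-.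
  by apply/eqP/eq_bigr => k _; rewrite [RHS]mxE liftK.
exists (exist _ (lsubmx x) ux) => //=.
rewrite -[RHS]hsubmxK -fx; congr (row_mx _ (f _)).
by apply: val_inj.
Qed.

Definition simplex_face : simplex S p :=
  Simplex face_in face_continuous face_sa.

End Faces.

Section Action.
Variables (R : rcfType) (n : nat) (S : symset R n) (p : nat).
Variables (s : 'S_n) (f : simplex S p).

Fact sperm_in t : symset_set S (col_perm s (f t)).
Proof. by apply: symset_perm; exact: simplex_in. Qed.

Fact sperm_continuous : continuous_simplex (fun t => col_perm s (f t)).
Proof.
move=> t e e0; have [d d0 fd] := simplex_continuous f t e0.
by exists d => // u ut j; rewrite !mxE; exact: fd.
Qed.

Fact sperm_sa : semialgebraic (graph_simplex (fun t => col_perm s (f t))).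
Proof.
pose q (j : 'I_(p.+1 + n)) : {mpoly R[p.+1 + n]} :=
  match fintype.split j with
  | inl j => 'X_(lshift n j)
  | inr j => 'X_(rshift p.+1 ((s^-1)%g j))
  end.
have qE (x : 'rV[R]_(p.+1 + n)) :
    \row_j (q j).@[x 0] = row_mx (lsubmx x) (col_perm s^-1 (rsubmx x)).
  apply/rowP => j; rewrite mxE /q mxE; case: fintype.splitP => k _;
  by rewrite mevalXU !mxE.
apply: sa_ext (sa_preimage q (simplex_sa f)); apply/esym.
apply/seteqP; split=> [_ [t _ <-]|x] /=.
  rewrite qE row_mxKl row_mxKr -col_permM mulVg col_perm1; by exists t.
case=> t _; rewrite qE => /eq_row_mx[tx fx]; exists t => //=.
by rewrite tx fx -col_permM mulgV col_perm1 hsubmxK.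
Qed.

Definition simplex_perm : simplex S p :=
  Simplex sperm_in sperm_continuous sperm_sa.

End Action.

Section Cohomology.
Variables (R : rcfType) (n : nat) (S : symset R n).

(* Singular cochains on continuous semi-algebraic simplices: over an arbitrary
   real closed field, these compute the cohomology that is obtained from
   semi-algebraic triangulations. *)
Definition cochain (p : nat) : lmodType rat := (simplex S p -> rat^o).

(* The inverse makes this a left action: it is the pullback along s^-1. *)
Definition cochain_act p (s : 'S_n) (c : cochain p) : cochain p :=
  fun f => c (simplex_perm s^-1 f).

Fact cochain_linear p s : linear (@cochain_act p s).
Proof. by []. Qed.
Fact cochain_act1 p c : @cochain_act p 1 c = c.
Proof.
apply/funext => f; congr (c _); apply: simplexP => t /=.
by rewrite invg1 col_perm1.
Qed.
Fact cochain_actM p s t c :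
  @cochain_act p (s * t) c = cochain_act s (cochain_act t c).
Proof.
apply/funext => f; congr (c _); apply: simplexP => u /=.
by rewrite invMg col_permM.
Qed.

Definition cochainModule p : snModule n :=
  SnModule (@cochain_linear p) (@cochain_act1 p) (@cochain_actM p).

Definition coboundary p (c : cochain p) : cochain p.+1 :=
  fun f => \sum_(i < p.+2) (-1) ^+ i * c (simplex_face i f).

Fact coboundary_linear p : linear (@coboundary p).
Proof.
move=> a b c; apply/funext => f.
transitivity (a * coboundary b f + coboundary c f); last by [].
rewrite /coboundary mulr_sumr -big_split.
by apply: eq_bigr => i _; rewrite /= mulrDr; congr (_ + _); exact: mulrCA.
Qed.

Fact coboundary_act p s (c : cochain p) :
  coboundary (cochain_act s c) = cochain_act s (coboundary c).
Proof.
apply/funext => f; apply: eq_bigr => i _; congr (_ * c _).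
exact: simplexP.
Qed.

Fact coboundary0 p : @coboundary p 0 = 0.
Proof. by apply/funext => f; apply: big1 => i _; exact: mulr0. Qed.

Definition is_cocycle p : {pred cochainModule p} :=
  fun c => `[< coboundary c = 0 >].

Fact cocycle0 p : 0 \in @is_cocycle p.
Proof. exact/asboolP/coboundary0. Qed.
Fact cocycleP p (a : rat) u v :
  u \in @is_cocycle p -> v \in @is_cocycle p -> a *: u + v \in @is_cocycle p.
Proof.
move=> /asboolP u0 /asboolP v0; apply/asboolP.
by rewrite coboundary_linear u0 v0 scaler0 addr0.
Qed.
Fact cocycle_act p s v :
  v \in @is_cocycle p -> snm_act s v \in @is_cocycle p.
Proof. by move=> /asboolP v0; apply/asboolP; rewrite coboundary_act v0. Qed.

Definition cocycles p : snModule n :=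
  subSnModule (SnSubmodule (@cocycle0 p) (@cocycleP p) (@cocycle_act p)).

Definition is_coboundary_prop p : cochain p -> Prop :=
  match p with
  | 0 => fun c => c = 0
  | q.+1 => fun c => exists b : cochain q, c = coboundary b
  end.

Definition is_coboundary p : {pred cocycles p} :=
  fun c => `[< is_coboundary_prop (sub_val c) >].

Fact coboundaries0 p : 0 \in @is_coboundary p.
Proof.
by apply/asboolP; case: p => [//|p]; exists 0; rewrite coboundary0.
Qed.
Fact coboundariesP p (a : rat) u v :
  u \in @is_coboundary p -> v \in @is_coboundary p ->
  a *: u + v \in @is_coboundary p.
Proof.
move=> /asboolP bu /asboolP bv; apply/asboolP; case: p => [|p] in u v bu bv *.
  by rewrite /= bu bv scaler0 addr0.
case: bu bv => [b /= ->] [c ->]; exists (a *: b + c).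
by rewrite coboundary_linear.
Qed.
Fact coboundaries_act p s v :
  v \in @is_coboundary p -> snm_act s v \in @is_coboundary p.
Proof.
move=> /asboolP bv; apply/asboolP; case: p => [|p] in v bv *.
  by rewrite /= bv.
by case: bv => b /= ->; exists (cochain_act s b); rewrite coboundary_act.
Qed.

Definition cohomology (p : nat) : snModule n :=
  quotSnModule (SnSubmodule (@coboundaries0 p) (@coboundariesP p)
                            (@coboundaries_act p)).

End Cohomology.

Definition is_partition (mu : seq nat) : bool :=
  sorted geq mu && (0%N \notin mu).

Definition partn (n : nat) : Type :=
  {mu : seq nat | is_partition mu && (sumn mu == n)}.

(* The partition (n - e, lambda_1, lambda_2, ...) of n, for lambda |- e. *)
Definition pad_seq (lambda : seq nat) (n : nat) : seq nat :=
  (n - sumn lambda)%N :: lambda.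

Fact pad_seqP (lambda : seq nat) (n : nat) :
  is_partition lambda -> (0 < n)%N -> (head 0 lambda + sumn lambda <= n)%N ->
  is_partition (pad_seq lambda n) && (sumn (pad_seq lambda n) == n).
Proof.
move=> /andP[sl l0] n0 ln; rewrite /is_partition /pad_seq /= inE negb_or l0.
have le : (sumn lambda <= n)%N by exact: leq_trans (leq_addl _ _) ln.
rewrite subnK // eqxx !andbT; apply/andP; split.
  case: lambda sl l0 ln le => [|a l] //= -> _ aln le.
  by rewrite andbT -(leq_add2r (a + sumn l)) subnK.
rewrite eq_sym -lt0n subn_gt0; case: lambda l0 ln {sl le} => [|a l] //=.
rewrite inE negb_or => /andP[a0 _]; apply: leq_trans.
by rewrite -[X in (X < _)%N]add0n ltn_add2r lt0n eq_sym.
Qed.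

Definition pad (lambda : seq nat) (n : nat) (hl : is_partition lambda)
    (hn : (0 < n)%N) (hln : (head 0 lambda + sumn lambda <= n)%N) : partn n :=
  exist _ (pad_seq lambda n) (pad_seqP hl hn hln).

Section Specht.
Variable n : nat.

(* A tabloid on {0, ..., n-1} is encoded by the function sending an entry to
   the index of its row, a tableau by the function sending an entry to its
   (row, column); all the permutation modules M^mu are contained in the space
   of functions on tabloids of arbitrary shape. *)
Definition tabloid := {ffun 'I_n -> 'I_n}.
Definition tableau := {ffun 'I_n -> 'I_n * 'I_n}.
Definition tabloid_space : vectType rat := {ffun tabloid -> rat^o}.

(* t is a bijection onto the Young diagram of mu |- n: it is injective into a
   set with n elements. *)
Definition is_tableau (mu : partn n) (t : tableau) : bool :=
  injectiveb t && [forall e, ((t e).2 < nth 0 (val mu) (t e).1)%N].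

(* Left action; it sends the basis vector at the tabloid r to the one at the
   tabloid r \o s, i.e. it moves the entry e to the row of s e. *)
Definition tabloid_act (s : 'S_n) (v : tabloid_space) : tabloid_space :=
  [ffun r : tabloid => v [ffun e => r ((s^-1)%g e)]].

Definition tabloid_vec (r : tabloid) : tabloid_space :=
  [ffun r' => (r' == r)%:R].

Definition tableau_tabloid (t : tableau) : tabloid := [ffun e => (t e).1].

Definition column_stab (t : tableau) : {set 'S_n} :=
  [set s : 'S_n | [forall e, (t (s e)).2 == (t e).2]]%SET.

Definition polytabloid (t : tableau) : tabloid_space :=
  \sum_(s in column_stab t)
    (-1) ^+ s *: tabloid_act s (tabloid_vec (tableau_tabloid t)).

Definition specht (mu : partn n) : {vspace tabloid_space} :=
  <<[seq polytabloid t | t <- enum (is_tableau mu)]>>%VS.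

Fact tabloid_linear s : linear (tabloid_act s).
Proof. by move=> a u v; apply/ffunP => r; rewrite !ffunE. Qed.

Fact tabloid_act1 v : tabloid_act 1 v = v.
Proof.
apply/ffunP => r; rewrite ffunE; congr (v _).
by apply/ffunP => e; rewrite ffunE invg1 perm1.
Qed.

Fact tabloid_actM s t v :
  tabloid_act (s * t) v = tabloid_act s (tabloid_act t v).
Proof.
apply/ffunP => r; rewrite !ffunE; congr (v _).
by apply/ffunP => e; rewrite !ffunE invMg permM.
Qed.

HB.instance Definition _ s := GRing.isLinear.Build rat _ _ _ (tabloid_act s)
  (tabloid_linear s).

Lemma tabloid_act_vec s r :
  tabloid_act s (tabloid_vec r) = tabloid_vec [ffun e => r (s e)].
Proof.
apply/ffunP => r'; rewrite !ffunE; congr ((nat_of_bool _)%:R).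
apply/idP/idP => /eqP.
  by move=> <-; apply/eqP/ffunP => e; rewrite !ffunE permK.
by move=> ->; apply/eqP/ffunP => e; rewrite !ffunE permKV.
Qed.

Fact polytabloid_act s t :
  tabloid_act s (polytabloid t) = polytabloid [ffun e => t (s e)].
Proof.
rewrite /polytabloid raddf_sum /=.
rewrite [RHS](reindex_inj (conjg_inj (s^-1)%g)) /=.
apply: eq_big => [c|c _].
  rewrite !inE; apply/forallP/forallP => ct e.
    by rewrite !ffunE conjgE invgK !permM permKV; exact: ct.
  have := ct ((s^-1)%g e).
  by rewrite !ffunE conjgE invgK !permM !permKV.
rewrite linearZ /= odd_permJ -tabloid_actM; congr (_ *: _).
rewrite !tabloid_act_vec; congr tabloid_vec; apply/ffunP => e.
by rewrite !ffunE conjgE invgK !permM permKV.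
Qed.

Fact specht_act s mu v : v \in specht mu -> tabloid_act s v \in specht mu.
Proof.
have limg : (linfun (tabloid_act s) @: specht mu <= specht mu)%VS.
  rewrite limg_span; apply/span_subvP => _ /mapP[_ /mapP[t tm ->] ->].
  rewrite lfunE /= polytabloid_act; apply: memv_span; apply: map_f.
  move: tm; rewrite !mem_enum !unfold_in => /andP[/injectiveP ti /forallP tm].
  apply/andP; split.
    apply/injectiveP => e e'; rewrite !ffunE => /ti; exact: perm_inj.
  by apply/forallP => e; rewrite ffunE.
move=> vs; apply: (subvP limg).
by rewrite -[tabloid_act s v](lfunE (tabloid_act s)) memv_img.
Qed.

(* The direct sum of m nu copies of the Specht module of nu, over all nu |- n,
   as the families indexed by the pairs (nu, i) with i < m nu and whose
   (nu, i)-component is in the Specht module of nu; there are finitely many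
   such pairs. *)
Definition family_space (m : partn n -> nat) : lmodType rat :=
  ({nu : partn n & 'I_(m nu)} -> tabloid_space).

Definition family_act m (s : 'S_n) (v : family_space m) : family_space m :=
  fun x => tabloid_act s (v x).

Fact family_linear m s : linear (@family_act m s).
Proof. by move=> a u v; apply/funext => x; exact: tabloid_linear. Qed.
Fact family_act1 m v : @family_act m 1 v = v.
Proof. by apply/funext => x; exact: tabloid_act1. Qed.
Fact family_actM m s t v :
  @family_act m (s * t) v = family_act s (family_act t v).
Proof. by apply/funext => x; exact: tabloid_actM. Qed.

Definition familyModule m : snModule n :=
  SnModule (@family_linear m) (@family_act1 m) (@family_actM m).

Definition in_specht_sum m : {pred familyModule m} :=
  fun v => `[< forall x, v x \in specht (tag x) >].

Fact specht_sum0 m : 0 \in @in_specht_sum m.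
Proof. by apply/asboolP => x; exact: mem0v. Qed.
Fact specht_sumP m (a : rat) u v :
  u \in @in_specht_sum m -> v \in @in_specht_sum m ->
  a *: u + v \in @in_specht_sum m.
Proof.
move=> /asboolP us /asboolP vs; apply/asboolP => x.
by apply: memvD => //; exact: memvZ.
Qed.
Fact specht_sum_act m s v :
  v \in @in_specht_sum m -> snm_act s v \in @in_specht_sum m.
Proof. by move=> /asboolP vs; apply/asboolP => x; exact: specht_act. Qed.

Definition specht_sum (m : partn n -> nat) : snModule n :=
  subSnModule (SnSubmodule (@specht_sum0 m) (@specht_sumP m)
                           (@specht_sum_act m)).

(* k is the multiplicity of the Specht module of mu in M: M is a finite direct
   sum of Specht modules, in which that of mu occurs k times, in this and any
   other such decomposition. *)
Definition is_multiplicity (M : snModule n) (mu : partn n) (k : nat) : Prop :=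
  (exists m, snm_iso M (specht_sum m) /\ m mu = k) /\
  (forall m, snm_iso M (specht_sum m) -> m mu = k).

End Specht.

(* Main.v *)
From HB Require Import structures.
Require Import Defs.
From mathcomp Require Import all_boot all_order all_algebra all_fingroup.
From mathcomp Require Import mpoly polyrcf ring lra.
From mathcomp Require Import boolp classical_sets.

(** The symmetric group acts trivially on the degree 0 cohomology of the zero
set Z_n of f = sum_i a_i e_i in R^n as soon as n > d + 1, and the dimension of
that cohomology is a nonincreasing function of n.  Hence only the trivial
representation occurs, with a multiplicity that is eventually constant.

The reason is that f is symmetric and affine in each variable: with x = (y, u),
  f(x) = f(u) + y f'(u),
where f' has the coefficients a_1, ..., a_d, hence a smaller degree.  So the
part of Z_n where f'(u) <> 0 is the graph of y = - f(u) / f'(u) over the open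
set f' <> 0 of R^(n-1), and the same holds for all level sets of f.  This
sets up an induction on d for three properties, together called [tame], of
the path components of {f = 0} and of {f <> 0}: every component is stable under
permutations, contains a point with a zero coordinate, and there are finitely
many components.  Zero coordinates and finiteness go through the graph
immediately.  For permutations, the graph gives invariance under those that fix
the first coordinate; conjugating these by the exchange of two coordinates
generates everything.

Two facts make every component meet the graph part.  At a point of Z_n where all
the first derivatives vanish, take a mixed derivative of minimal order which is
nonzero: as f is affine in each coordinate, moving one coordinate along a line
contained in Z_n lowers this order ([regularize]).  Once the derivative with
respect to some coordinate z is nonzero, one gets a nonzero derivative with
respect to the first coordinate by a small perturbation, because on Z_n the
product of these derivatives is f'(w)^2 - f(w) f''(w), where w consists of the
remaining coordinates, and this is not identically zero ([turan_neq0]).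

For cohomology, a 0-cocycle takes equal values at the ends of a path, so it
is a function on components: invariance gives the trivial action, finiteness
gives finite dimension, and zero coordinates show that restricting cocycles from
Z_(n+1) to Z_n = Z_(n+1) /\ {x_0 = 0} is injective.  No two components ever need
to be told apart.  Finally a trivial module is a multiple of the Specht module
of (n), and of no other one, since a column transposition acts as -1 on
a polytabloid. *)

Set Implicit Arguments.
Unset Strict Implicit.
Unset Printing Implicit Defensive.

Import Order.TTheory GRing.Theory Num.Theory.

Local Open Scope ring_scope.

(** * Linear combinations of elementary symmetric functions *)

Section SymLin.
Variable R : rcfType.
Implicit Types (a x u w : seq R) (y z : R).

(** The value at the point x of the sum of the a_i e_i.  The recursion on the
point is the decomposition e_i(y, u) = e_i(u) + y e_(i-1)(u), so that dropping
the first coefficient is partial differentiation. *)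
Fixpoint symlin a x : R :=
  if x is y :: u then symlin a u + y * symlin (behead a) u else head 0 a.

Lemma symlin_nil x : symlin [::] x = 0.
Proof. by elim: x => //= y x ->; rewrite mulr0 addr0. Qed.

Lemma symlin1 c x : symlin [:: c] x = c.
Proof. by elim: x => //= y x ->; rewrite symlin_nil mulr0 addr0. Qed.

Lemma symlin_zeros a k : symlin a (nseq k 0) = head 0 a.
Proof. by elim: k a => //= k IH a; rewrite IH mul0r addr0. Qed.

Lemma symlin_const c a x : symlin (c :: a) x = c + symlin (0 :: a) x.
Proof. by elim: x => [|y x /= ->] /=; [rewrite addr0|rewrite addrA]. Qed.

Lemma symlin_insert a x y u : symlin a (x ++ y :: u) = symlin a (y :: x ++ u).
Proof.
elim: x a => //= z x IH a; rewrite !IH /=.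
set p := symlin _ _; set q := symlin _ _; set r := symlin _ _; ring.
Qed.

Lemma perm_symlin a x u : perm_eq x u -> symlin a x = symlin a u.
Proof.
apply: catCA_perm_subst => {}x {}u w; elim: x a => [|y x IH] a //=.
by rewrite symlin_insert /= !IH.
Qed.

Lemma symlin_horner a (ps : seq {poly R}) :
  exists p : {poly R}, forall t, symlin a [seq q.[t] | q <- ps] = p.[t].
Proof.
elim: ps a => [|q ps IH] a /=.
  by exists (head 0 a)%:P => t; rewrite hornerC.
have [p1 E1] := IH a; have [p2 E2] := IH (behead a).
by exists (p1 + q * p2) => t; rewrite E1 E2 !hornerE.
Qed.

(** If z = - symlin a (y :: x) / symlin (behead a) (y :: x), so that the point
(z, y, x) is a zero, then this is the product of the partial derivatives with
respect to z and y at that point.  It does not depend on y. *)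
Definition turan a x :=
  symlin (behead a) x ^+ 2 - symlin a x * symlin (behead (behead a)) x.

Lemma turan_cons a y x :
  turan a (y :: x) =
  y ^+ 2 * turan (behead a) x +
  y * (symlin (behead a) x * symlin (behead (behead a)) x -
       symlin a x * symlin (behead (behead (behead a))) x) + turan a x.
Proof. rewrite /turan /=; ring. Qed.

(** The coefficient of y ^+ 2 in [turan_cons] is the same expression for the
derived coefficients; after differentiating down to degree 1, the expression is
the square of the top coefficient. *)
Lemma turan_neq0 c a k : last 0 a != 0 -> (size a <= k.+1)%N ->
  exists2 x, size x = k & turan (c :: a) x != 0.
Proof.
elim: a k c => [|b a IH] k c /=; first by rewrite eqxx.
case: a IH => [_ b0 _|b' a IH nz].
  exists (nseq k 0); first by rewrite size_nseq.
  by rewrite /turan !symlin_zeros /= mulr0 subr0 expf_neq0.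
case: k => // k; rewrite ltnS => ak; have [x sx Dx] := IH k b nz ak.
set q := symlin (behead [:: c, b, b' & a]) x *
         symlin (behead (behead [:: c, b, b' & a])) x -
       symlin [:: c, b, b' & a] x *
         symlin (behead (behead (behead [:: c, b, b' & a]))) x.
have Ex y : turan [:: c, b, b' & a] (y :: x) =
  y ^+ 2 * turan [:: b, b' & a] x + y * q + turan [:: c, b, b' & a] x.
  exact: turan_cons.
have [E|nE] := eqVneq (turan [:: c, b, b' & a] x) 0; last first.
  by exists (0 :: x); [rewrite /= sx|rewrite Ex expr0n !mul0r !add0r].
have [E1|nE1] := eqVneq (turan [:: c, b, b' & a] (1 :: x)) 0; last first.
  by exists (1 :: x); rewrite /= ?sx.
(* A polynomial of degree 2 with zeros 0, 1 and -1 would be zero. *)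
exists (-1 :: x); rewrite /= ?sx //; apply: contra Dx => /eqP E2.
apply/eqP; rewrite !Ex E in E1 E2; lra.
Qed.

End SymLin.

(** * Rational curves and the points that they link *)

Section Curves.
Variable R : rcfType.
Implicit Types (f g : R -> R) (t : R) (gam : R -> seq R).

(** Rational functions without a pole in [0, 1].  They form the smallest class
that contains the parametrizations of lines and allows one to solve an equation
of degree 1 along a curve, and their graphs are visibly semialgebraic. *)
Definition regular f := exists N D : {poly R},
  forall t, 0 <= t <= 1 -> D.[t] != 0 /\ f t = N.[t] / D.[t].

Lemma regular_horner (p : {poly R}) : regular (horner p).
Proof. by exists p, 1 => t _; rewrite hornerC oner_neq0 divr1. Qed.

Lemma regular_cst c : regular (fun=> c).
Proof. by exists c%:P, 1 => t _; rewrite !hornerC oner_neq0 divr1. Qed.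

Lemma eq_regular f g : (forall t, 0 <= t <= 1 -> f t = g t) ->
  regular g -> regular f.
Proof.
move=> fg [N [D ND]]; exists N, D => t t01.
by have [D0 gE] := ND t t01; rewrite fg.
Qed.

Lemma regularD f g : regular f -> regular g -> regular (fun t => f t + g t).
Proof.
move=> [N [D ND]] [N' [D' ND']]; exists (N * D' + N' * D), (D * D') => t t01.
have [D0 ->] := ND t t01; have [D0' ->] := ND' t t01.
by rewrite !hornerE mulf_neq0 // addf_div.
Qed.

Lemma regularM f g : regular f -> regular g -> regular (fun t => f t * g t).
Proof.
move=> [N [D ND]] [N' [D' ND']]; exists (N * N'), (D * D') => t t01.
have [D0 ->] := ND t t01; have [D0' ->] := ND' t t01.
by rewrite !hornerM mulf_neq0 //= mulf_div.
Qed.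

Lemma regularV f : (forall t, 0 <= t <= 1 -> f t != 0) ->
  regular f -> regular (fun t => (f t)^-1).
Proof.
move=> f0 [N [D ND]]; exists D, N => t t01.
have := f0 t t01; have [D0 ->] := ND t t01.
by rewrite mulf_eq0 negb_or => /andP[N0 _]; rewrite N0 invf_div.
Qed.

Definition curve m gam :=
  (forall t, size (gam t) = m) /\ (forall i, regular (fun t => (gam t)`_i)).

Lemma curve_cst x : curve (size x) (fun=> x).
Proof. by split=> // i; exact: regular_cst. Qed.

Lemma curve_horner (ps : seq {poly R}) :
  curve (size ps) (fun t => [seq p.[t] | p <- ps]).
Proof.
split=> [t|i]; first by rewrite size_map.
apply: (eq_regular _ (regular_horner ps`_i)) => t _.
have [ip|pi] := ltnP i (size ps); first by rewrite (nth_map 0).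
by rewrite !nth_default ?size_map // horner0.
Qed.

Lemma curve_cons m f gam : regular f -> curve m gam ->
  curve m.+1 (fun t => f t :: gam t).
Proof.
by move=> rf [sg rg]; split=> [t|[|i]] //=; rewrite sg.
Qed.

Lemma curve_behead m gam : curve m.+1 gam -> curve m (fun t => behead (gam t)).
Proof.
move=> [sg rg]; split=> [t|i]; first by rewrite size_behead sg.
by apply: (eq_regular _ (rg i.+1)) => t _; rewrite nth_behead.
Qed.

Lemma curve_reindex m gam (js : seq nat) : curve m gam ->
  curve (size js) (fun t => [seq (gam t)`_j | j <- js]).
Proof.
move=> [sg rg]; split=> [t|i]; first by rewrite size_map.
have [ij|ji] := ltnP i (size js).
  by apply: (eq_regular _ (rg (nth 0%N js i))) => t _; rewrite (nth_map 0%N).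
apply: (eq_regular _ (regular_cst 0)) => t _.
by rewrite nth_default ?size_map.
Qed.

Lemma regular_symlin a m gam : curve m gam ->
  regular (fun t => symlin a (gam t)).
Proof.
elim: m a gam => [|m IH] a gam cg.
  apply: (eq_regular _ (regular_cst (head 0 a))) => t _.
  by case: (gam t) (cg.1 t).
have cb := curve_behead cg.
apply: (eq_regular _ (regularD (IH a _ cb)
  (regularM (cg.2 0%N) (IH (behead a) _ cb)))) => t _.
by case: (gam t) (cg.1 t).
Qed.

End Curves.

Section Linked.
Variable R : rcfType.
Implicit Types (P Q : pred (seq R)) (x y u : seq R) (gam : R -> seq R).

(** A function on points that is constant along the curves in P, such as
the function given by a 0-cocycle. *)
Definition curve_constant m P (h : seq R -> rat) := forall gam, curve m gam ->
  (forall t, 0 <= t <= 1 -> P (gam t)) -> h (gam 0) = h (gam 1).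

(** Testing with all the functions that are constant along curves, instead of
concatenating curves, makes this an equivalence relation at once. *)
Definition linked m P x y := forall h, curve_constant m P h -> h x = h y.

Lemma linked_sym m P x y : linked m P x y -> linked m P y x.
Proof. by move=> xy h hP; rewrite xy. Qed.

Lemma linked_trans m P y x z :
  linked m P x y -> linked m P y z -> linked m P x z.
Proof. by move=> xy yz h hP; rewrite xy // yz. Qed.

Lemma linked_curve m P gam : curve m gam ->
  (forall t, 0 <= t <= 1 -> P (gam t)) -> linked m P (gam 0) (gam 1).
Proof. by move=> cg gP h; apply. Qed.

Lemma linked_sub m P Q x y : {subset P <= Q} ->
  linked m P x y -> linked m Q x y.
Proof.
by move=> PQ xy h hQ; apply: xy => gam cg gP; apply: hQ => // t /gP/PQ.
Qed.

Lemma linked_line m x y : size x = m -> size y = m ->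
  linked m predT x y.
Proof.
move=> sx sy.
pose ps := [seq p.1%:P + 'X * (p.2 - p.1)%:P | p <- zip x y].
have sp : size ps = m by rewrite size_map size_zip sx sy minnn.
have := @linked_curve m predT _ _ (fun _ _ => isT); rewrite -[in curve m]sp.
move=> /(_ _ (curve_horner ps)); congr (linked _ _ _ _); rewrite -map_comp.
  rewrite -[RHS](@unzip1_zip _ _ x y) ?sx ?sy //; apply: eq_map => p /=.
  by rewrite !hornerE.
rewrite -[RHS](@unzip2_zip _ _ x y) ?sx ?sy //; apply: eq_map => p /=.
by rewrite hornerD hornerM hornerX !hornerC mul1r addrC subrK.
Qed.

(** Functions that are constant along curves can be pulled back. *)
Lemma linked_map m n P Q (F : seq R -> seq R) x y :
  (forall gam, curve m gam -> (forall t, 0 <= t <= 1 -> P (gam t)) ->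
     curve n (fun t => F (gam t)) /\
     (forall t, 0 <= t <= 1 -> Q (F (gam t)))) ->
  linked m P x y -> linked n Q (F x) (F y).
Proof.
move=> FP xy h hQ; apply: (xy (h \o F)) => gam cg gP /=.
by have [cF QF] := FP gam cg gP; exact: (hQ (fun t => F (gam t))).
Qed.

(** Permutations of the coordinates as functions on points, so that they
apply to the curves too. *)
Definition reindex (js : seq nat) x : seq R := [seq x`_j | j <- js].

Lemma reindex_perm m js x : size x = m -> perm_eq js (iota 0 m) ->
  perm_eq (reindex js x) x.
Proof.
move=> sx jm; rewrite -[X in perm_eq _ X](mkseq_nth 0) /mkseq sx.
exact: perm_map.
Qed.

Lemma perm_reindex m x y : size y = m -> perm_eq x y ->
  exists2 js, perm_eq js (iota 0 m) & x = reindex js y.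
Proof.
by move=> sy /(perm_iotaP 0)[js pj ->]; exists js => //; rewrite -sy.
Qed.

Lemma linked_reindex m P js x y :
  (forall x y, perm_eq x y -> P x = P y) -> perm_eq js (iota 0 m) ->
  linked m P x y -> linked m P (reindex js x) (reindex js y).
Proof.
move=> Pperm jm; apply: linked_map => gam cg gP; split.
  by have := curve_reindex js cg; rewrite (perm_size jm) size_iota.
move=> t t01; rewrite (Pperm _ (gam t)) ?gP //.
by apply: reindex_perm jm; exact: cg.1.
Qed.

(** A permutation transports everything that is linked to x. *)
Lemma linked_perm m P x x' y :
  (forall x y, perm_eq x y -> P x = P y) -> size x = m -> size y = m ->
  perm_eq x' x -> linked m P x y ->
  exists2 y', perm_eq y' y & linked m P x' y'.
Proof.
move=> Pperm sx sy /(perm_reindex sx)[js jm ->] xy; exists (reindex js y).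
  exact: reindex_perm jm.
exact: linked_reindex.
Qed.

End Linked.

(** * The components of the zero set and of its complement *)

Section Tame.
Variable R : rcfType.
Implicit Types (a x y u v w : seq R) (c s : R) (P Q : pred (seq R)).

(** In terms of the components of P in R^m: each one is stable under
permutations, each one contains a point with a zero coordinate, and there are
finitely many. *)
Definition tame m P :=
  [/\ forall x y, size x = m -> P x -> perm_eq x y -> linked m P x y,
      forall x, size x = m -> P x ->
        exists y, [/\ size y = m, P y, 0 \in y & linked m P x y]
    & exists rs : seq (seq R),
        all [pred y | (size y == m) && P y] rs /\
        forall x, size x = m -> P x -> exists2 y, y \in rs & linked m P x y].

Definition zeros a : pred (seq R) := fun x => symlin a x == 0.
Definition nonzeros a : pred (seq R) := fun x => symlin a x != 0.

Lemma zeros_perm a x y : perm_eq x y -> zeros a x = zeros a y.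
Proof. by move=> xy; rewrite /zeros (perm_symlin _ xy). Qed.

Lemma tame_predT m : (0 < m)%N -> tame m predT.
Proof.
move=> m0; split=> [x y sx _ xy|x sx _|].
- by apply: linked_line => //; rewrite -(perm_size xy).
- exists (nseq m 0); rewrite size_nseq mem_nseq m0 eqxx; split=> //.
  by apply: linked_line; rewrite ?size_nseq.
- exists [:: nseq m 0]; rewrite /= size_nseq eqxx; split=> // x sx _.
  by exists (nseq m 0); rewrite ?inE //; apply: linked_line; rewrite ?size_nseq.
Qed.

Lemma tame_pred0 m : tame m pred0.
Proof. by split=> //; exists [::]. Qed.

(** The first coordinate is solved for on the level set of value c. *)
Definition solve a c u : seq R :=
  ((c - symlin a u) / symlin (behead a) u) :: u.

Lemma solveP a c u : symlin (behead a) u != 0 -> symlin a (solve a c u) = c.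
Proof. by move=> u0; rewrite /= divfK // addrC subrK. Qed.

Lemma solve_id a s u : symlin (behead a) u != 0 ->
  solve a (symlin a (s :: u)) u = s :: u.
Proof. by move=> u0; rewrite /solve /= addrC addKr mulfK. Qed.

Lemma curve_solve m a f (gam : R -> seq R) : curve m gam -> regular f ->
  (forall t, 0 <= t <= 1 -> symlin (behead a) (gam t) != 0) ->
  curve m.+1 (fun t => solve a (f t) (gam t)).
Proof.
move=> cg rf g0; apply: curve_cons => //; apply: regularM.
  apply: regularD => //; apply: (@eq_regular _ _ (fun t => -1 * symlin a (gam t))).
    by move=> t _; rewrite mulN1r.
  apply: regularM; [exact: regular_cst|exact: regular_symlin cg].
by apply: regularV => //; exact: regular_symlin cg.
Qed.

Lemma linked_solve m a u v : linked m (nonzeros (behead a)) u v ->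
  linked m.+1 (zeros a) (solve a 0 u) (solve a 0 v).
Proof.
apply: (linked_map (F := solve a 0)) => gam cg gP; split.
  by apply: (curve_solve cg) => //; exact: regular_cst.
by move=> t t01; rewrite /zeros solveP ?eqxx //; exact: gP.
Qed.


(** If the derivative with respect to s vanishes at a zero, then the whole line
in the direction of s consists of zeros. *)
Lemma linked_coord m a x s c u : size x = m -> perm_eq x (s :: u) ->
  symlin a x = 0 -> symlin (behead a) u = 0 ->
  exists2 x', perm_eq x' (c :: u) & linked m (zeros a) x x'.
Proof.
move=> sx xsu fx fu; have su : size (s :: u) = m by rewrite -(perm_size xsu).
apply: (@linked_perm _ m (zeros a) (s :: u) x (c :: u) (@zeros_perm a)) => //.
pose gam t := (s%:P + 'X * (c - s)%:P).[t] :: u.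
have -> : s :: u = gam 0 by rewrite /gam !hornerE.
have -> : c :: u = gam 1.
  by rewrite /gam hornerD hornerM hornerX !hornerC mul1r addrC subrK.
apply: linked_curve; rewrite -?su.
  by apply: curve_cons; [exact: regular_horner|exact: curve_cst].
move=> t _; rewrite /zeros /= fu mulr0.
by rewrite (perm_symlin _ xsu) /= fu mulr0 in fx; rewrite fx.
Qed.


(** Membership in P is itself constant along the curves in P. *)
Lemma linked_in m P x y : size x = m -> P x -> linked m P x y ->
  size y = m /\ P y.
Proof.
move=> sx Px xy; pose h z : rat := ((size z == m) && P z)%:R.
have : h x = h y.
  by apply: xy => gam cg gP; rewrite /h !cg.1 !gP // ?lexx ?ler01.
rewrite /h sx Px eqxx; move/eqP; rewrite eqr_nat.
by case: (eqVneq (size y) m) => //=; case: (P y).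
Qed.

(** The hypothesis says that the mixed derivative with respect to the
coordinates in v is nonzero at x.  Unless x is already regular, either
a derivative of smaller order is nonzero there, or it becomes nonzero when one
of the coordinates in v is moved: the derivative of order one less is an affine
function of that coordinate with a nonzero slope. *)
Lemma regularize m a v u x : size x = m -> symlin a x = 0 ->
  perm_eq x (v ++ u) -> symlin (drop (size v) a) u != 0 ->
  exists x' s w, [/\ linked m (zeros a) x x', perm_eq x' (s :: w)
                    & symlin (behead a) w != 0].
Proof.
elim: v x u => [|s v IH] x u sx fx xvu.
  by rewrite drop0 -(perm_symlin a xvu) fx eqxx.
case: v IH xvu => [|c v] IH xvu.
  by rewrite /= drop1 => nz; exists x, s, u.
have [z|nz _] := eqVneq (symlin (behead a) (c :: v ++ u)) 0; last first.
  by exists x, s, (c :: v ++ u).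
set vu := c :: v in IH xvu * => nz.
have permE r : perm_eq (r :: vu ++ u) (vu ++ r :: u).
  exact/permPl/(perm_catCA [:: r] vu u).
have [E|nE] := eqVneq (symlin (drop (size vu) a) (s :: u)) 0; last first.
  by exact: (IH x (s :: u) sx fx (perm_trans xvu (permE s)) nE).
have [y yE xy] := linked_coord (s + 1) sx xvu fx z.
have [sy /eqP fy] := linked_in sx (introT eqP fx : zeros a x) xy.
have E1 : symlin (drop (size vu) a) (s + 1 :: u) != 0.
  move: nz E => /=; rewrite -drop1 drop_drop add1n /= => nz E.
  by rewrite mulrDl addrA E add0r mul1r.
have [x' [r [w [yx' x'E w0]]]] := IH y _ sy fy (perm_trans yE (permE _)) E1.
by exists x', r, w; split=> //; exact: linked_trans xy yx'.
Qed.

Lemma reindex_swap k c s w : size w = k ->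
  reindex [:: 1%N, 0%N & iota 2 k] [:: c, s & w] = [:: s, c & w].
Proof.
move=> <-; rewrite /reindex !map_cons -[2%N]/(2 + 0)%N iotaDl -map_comp.
by congr [:: _, _ & _]; rewrite -[RHS](mkseq_nth 0).
Qed.

Lemma linked_swap k a c s w c' s' w' : size w = k -> size w' = k ->
  linked k.+2 (zeros a) [:: c, s & w] [:: c', s' & w'] ->
  linked k.+2 (zeros a) [:: s, c & w] [:: s', c' & w'].
Proof.
move=> sw sw' L; rewrite -(reindex_swap _ _ sw) -(reindex_swap _ _ sw').
apply: linked_reindex L; first exact: zeros_perm.
by rewrite -[iota 0 _]/[:: 0%N, 1%N & iota 2 k] (perm_catCA [:: 1%N] [:: 0%N]).
Qed.

Lemma linked_tail m a c x d y x' : size x = m -> size y = m -> perm_eq x' x ->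
  linked m.+1 (zeros a) (c :: x) (d :: y) ->
  exists2 y', perm_eq y' y & linked m.+1 (zeros a) (c :: x') (d :: y').
Proof.
move=> sx sy /(perm_reindex sx)[js jm ->] L; exists (reindex js y).
  exact: reindex_perm jm.
have jm1 : perm_eq (0%N :: map S js) (iota 0 m.+1).
  by rewrite /= perm_cons -[1%N]/(1 + 0)%N iotaDl; exact: perm_map.
have E e z : e :: reindex js z = reindex (0%N :: map S js) (e :: z).
  by rewrite /reindex /= -map_comp.
by rewrite !E; apply: linked_reindex L => //; exact: zeros_perm.
Qed.

(** A nonzero polynomial has no root just to the right of 0. *)
Lemma small_parameter (p q : {poly R}) : p.[0] != 0 -> q != 0 ->
  exists2 e, 0 < e & (forall t, 0 <= t <= 1 -> p.[t * e] != 0) /\ q.[e] != 0.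
Proof.
move=> p0 q0; have pq0 : p * q != 0.
  by rewrite mulf_neq0 //; apply: contra p0 => /eqP ->; rewrite horner0.
have [e en] := neighpr_wit (@ltr01 R) pq0.
have no_root t : 0 < t -> t <= e -> (p * q).[t] != 0.
  move=> t0 te; apply: (@neighpr_root _ (p * q) 0 1 t).
  by move: en; rewrite /neighpr !in_itv /= t0 => /andP[_]; exact: le_lt_trans.
have e0 : 0 < e by move: en; rewrite /neighpr in_itv /= => /andP[].
exists e => //; split=> [t /andP[t0 t1]|].
  move: t0; rewrite le_eqVlt => /predU1P[<-|t0]; first by rewrite mul0r.
  have := no_root (t * e) (mulr_gt0 t0 e0).
  rewrite ler_piMl ?(ltW e0) // => /(_ isT).
  by rewrite hornerM mulf_eq0 negb_or => /andP[].
have := no_root e e0 (lexx _).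
by rewrite hornerM mulf_eq0 negb_or => /andP[].
Qed.

(** The open set {symlin a <> 0} contains the beginning of the segment from x
to y, and a polynomial function that is nonzero at y has only finitely many
zeros on it. *)
Lemma perturb m a x y (f : seq R -> R) : size x = m -> size y = m ->
  (forall ps : seq {poly R}, exists p : {poly R},
     forall t, f [seq q.[t] | q <- ps] = p.[t]) ->
  symlin a x != 0 -> f y != 0 ->
  exists z, [/\ size z = m, linked m (nonzeros a) x z & f z != 0].
Proof.
move=> sx sy f_poly ax fy.
pose line (c : {poly R}) := [seq p.1%:P + c * (p.2 - p.1)%:P | p <- zip x y].
have lineE (c : {poly R}) t : [seq q.[t] | q <- line c] =
    [seq p.1 + c.[t] * (p.2 - p.1) | p <- zip x y].
  by rewrite -map_comp; apply: eq_map => p /=; rewrite hornerD hornerM !hornerC.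
have line0 : [seq p.1 + 0 * (p.2 - p.1) | p <- zip x y] = x.
  rewrite -[RHS](@unzip1_zip _ _ x y) ?sx ?sy //; apply: eq_map => p /=.
  by rewrite mul0r addr0.
have line1 : [seq p.1 + 1 * (p.2 - p.1) | p <- zip x y] = y.
  rewrite -[RHS](@unzip2_zip _ _ x y) ?sx ?sy //; apply: eq_map => p /=.
  by rewrite mul1r addrC subrK.
have [p pE] := symlin_horner a (line 'X).
have [q qE] := f_poly (line 'X).
have [||e e0 [pe qe]] := @small_parameter p q.
- by rewrite -pE lineE hornerX line0.
- apply: contra fy => /eqP q0; have := qE 1.
  by rewrite lineE hornerX line1 q0 horner0 => ->.
pose gam t := [seq r.[t] | r <- line ('X * e%:P)].
exists (gam 1); split; first by rewrite !size_map size_zip sx sy minnn.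
  have -> : x = gam 0 by rewrite /gam lineE hornerM hornerX mul0r line0.
  apply: linked_curve => [|t t01].
    have := curve_horner (line ('X * e%:P)).
    by rewrite !size_map size_zip sx sy minnn.
  have := pe t t01; rewrite -pE !lineE /nonzeros /gam lineE.
  by rewrite hornerM hornerC !hornerX.
move: qe; rewrite -qE /gam !lineE hornerM hornerC !hornerX.
by rewrite mul1r.
Qed.

(** From a regular point, where some coordinate s has a nonzero derivative,
s is solved for, and the other coordinates (e, w) are moved until [turan] is
nonzero at w; then the derivative with respect to e is nonzero. *)
Lemma head_regular k c b x : last 0 b != 0 -> (size b <= k.+1)%N ->
  size x = k.+2 -> symlin (c :: b) x = 0 ->
  exists s w, linked k.+2 (zeros (c :: b)) x (s :: w) /\ symlin b w != 0.
Proof.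
move=> b0 bk sx fx; set a := c :: b.
have dropa : drop (size b) a = [:: last 0 b].
  rewrite /a lastI -cats1 -{1}(size_belast c b) drop_size_cat //.
  by case: (b) b0 => //=; rewrite eqxx.
have [||x' [s [w [xx' x'E w0]]]] := @regularize _ a (take (size b) x)
  (drop (size b) x) x sx fx.
- by rewrite cat_take_drop.
- by rewrite size_takel ?sx 1?(leq_trans bk) // dropa symlin1.
have [sx' /eqP fx'] := linked_in sx (introT eqP fx : zeros a x) xx'.
case: x' sx' x'E fx' xx' => // e x1 [sx1] x'E fx' xx'.
have [es|nes] := eqVneq e s.
  exists e, x1; split=> //; rewrite -(_ : symlin b w = symlin b x1) //.
  by apply: perm_symlin; move: x'E; rewrite es perm_cons perm_sym.
have sx1' : s \in x1.
  by have := perm_mem x'E s; rewrite !inE eqxx eq_sym (negPf nes).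
have x1E := perm_to_rem sx1'; set w1 := rem s x1 in x1E.
have sw1 : size w1 = k by rewrite size_rem // sx1.
have wE : perm_eq w (e :: w1).
  rewrite -(perm_cons s) perm_sym -(permPr x'E).
  rewrite -[X in perm_eq X _]/([:: s] ++ [:: e] ++ w1) perm_catCA /=.
  by rewrite perm_cons perm_sym.
rewrite (perm_symlin _ wE) in w0.
have [wt swt turan_wt] := turan_neq0 c b0 bk.
have [|||||z [sz ez turan_z]] := @perturb k.+1 b (e :: w1) (e :: wt)
  (fun z => turan a (behead z)) => //=; rewrite ?sw1 ?swt //.
  move=> ps; case: (symlin_horner a (behead ps)) => p1 E1.
  case: (symlin_horner b (behead ps)) => p2 E2.
  case: (symlin_horner (behead b) (behead ps)) => p3 E3.
  exists (p2 ^+ 2 - p1 * p3) => t.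
  by rewrite behead_map /turan /= E1 E2 E3 !hornerE.
case: z sz ez turan_z => // d w2 [sw2] ew2 turan_w2.
have [_ dw2] := linked_in (congr1 S sw1 : size (e :: w1) = k.+1) w0 ew2.
have f1 : symlin a (s :: e :: w1) = 0.
  rewrite -fx'; apply: perm_symlin; rewrite -(perm_cons e) in x1E.
  by rewrite perm_sym (perm_trans x1E) // (perm_catCA [:: e] [:: s]).
(* The coordinate that is solved for comes first in [solve], but the point has
   e in front: the two are exchanged, and the tail is put in order. *)
have L1 := linked_solve (a := a) ew2.
rewrite -[X in solve _ X (e :: w1)]f1 (solve_id (a := a)) // in L1.
have L2 := linked_swap sw1 sw2 L1.
have [||y yE L3] := linked_tail _ _ x1E L2; rewrite /= ?sw1 ?sw2 //.
exists d, y; split; first exact: linked_trans xx' L3.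
apply: contra turan_w2; rewrite (perm_symlin _ yE) /= => /eqP E.
have -> : turan a w2 = symlin b (d :: w2) *
  (symlin b w2 + (0 - symlin a (d :: w2)) / symlin b (d :: w2) * symlin (behead b) w2).
  by move: dw2; rewrite /nonzeros /turan /= => ?; field.
by rewrite E mulr0.
Qed.

(** Every zero is linked to a point of the graph of the first coordinate over
{symlin b <> 0}, and links in the base of the graph lift to it. *)
Lemma tame_zeros k c b : last 0 b != 0 -> (size b <= k)%N ->
  tame k.+1 (nonzeros b) -> tame k.+2 (zeros (c :: b)).
Proof.
move=> b0 bk [permb zerob [rs [rsP rs_cover]]]; set a := c :: b.
have bk1 : (size b <= k.+1)%N by exact: leqW.
have toregular x : size x = k.+2 -> zeros a x -> exists w,
    [/\ size w = k.+1, nonzeros b w & linked k.+2 (zeros a) x (solve a 0 w)].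
  move=> sx /eqP fx; have [s [w [xw w0]]] := head_regular b0 bk1 sx fx.
  have [[sw] /eqP fw] := linked_in sx (introT eqP fx : zeros a x) xw.
  by exists w; split=> //; rewrite -fw (solve_id (a := a)).
have tail s x y : size x = k.+1 -> zeros a (s :: x) -> perm_eq x y ->
    linked k.+2 (zeros a) (s :: x) (s :: y).
  move=> sx fx xy; have [w [sw w0 xw]] := toregular (s :: x) (congr1 S sx) fx.
  have yx : perm_eq y x by rewrite perm_sym.
  have [w' w'w yw'] := linked_tail sx sw yx xw.
  apply: linked_trans xw _; apply: linked_sym; apply: linked_trans yw' _.
  apply: linked_sym; have ww' : perm_eq w w' by rewrite perm_sym.
  have := linked_solve (a := a) (permb w w' sw w0 ww').
  by rewrite {2}/solve /= (perm_symlin _ w'w) (perm_symlin (behead a) w'w).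
split.
- have k0 : (0 < k)%N by apply: leq_trans bk; case: (b) b0 => //=; rewrite eqxx.
  case: k k0 tail {bk permb zerob rs rsP rs_cover bk1 toregular} => // k _ tail.
  (* The transpositions (1 2) and (0 2) suffice: the former fixes the head, and
     the latter is its conjugate by the exchange of the first two entries. *)
  have swap p q e w : size w = k -> zeros a [:: p, q, e & w] ->
      linked k.+3 (zeros a) [:: p, q, e & w] [:: q, p, e & w].
    move=> sw fw; have sw1 r : size (r :: w) = k.+1 by rewrite /= sw.
    have sw2 r r' : size [:: r, r' & w] = k.+2 by rewrite /= sw.
    have pC r r' : perm_eq [:: r, r' & w] [:: r', r & w].
      exact/permPl/(perm_catCA [:: r] [:: r'] w).
    have fperm v : perm_eq [:: p, q, e & w] v -> zeros a v.
      by move=> pv; rewrite -(zeros_perm a pv).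
    have f1 : zeros a [:: e, p, q & w].
      by apply: fperm; rewrite perm_sym (perm_catCA [:: e] [:: p; q]).
    have f2 : zeros a [:: q, e, p & w].
      by apply: fperm; rewrite (perm_catCA [:: p] [:: q; e]).
    apply: linked_trans (tail p _ _ (sw2 _ _) fw (pC _ _)) _.
    apply: linked_trans (tail q _ _ (sw2 _ _) f2 (pC _ _)).
    apply: linked_swap (sw1 _) (sw1 _) _.
    exact: tail (sw2 _ _) f1 (pC _ _).
  move=> [//|p x] y [sx] fx pxy.
  have sy : size y = k.+3 by rewrite -(perm_size pxy) /= sx.
  case: y sy pxy => // q y [sy] pxy.
  have [pq|npq] := eqVneq p q.
    by rewrite -pq; apply: tail => //; move: pxy; rewrite -pq perm_cons.
  have qx : q \in x.
    by have := perm_mem pxy q; rewrite !inE eqxx eq_sym (negPf npq).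
  have xE := perm_to_rem qx; have := perm_size xE; rewrite sx.
  case: (rem q x) xE => // e w xE [sw].
  apply: linked_trans (tail p _ _ sx fx xE) _.
  have pqE : perm_eq (p :: x) [:: p, q, e & w] by rewrite perm_cons.
  have fpq : zeros a [:: p, q, e & w] by rewrite -(zeros_perm a pqE).
  have qpE : perm_eq [:: p, q, e & w] [:: q, p, e & w].
    exact/permPl/(perm_catCA [:: p] [:: q]).
  apply: linked_trans (swap _ _ _ _ (esym sw) fpq) (tail _ _ _ _ _ _).
  - by rewrite /= -sw.
  - by rewrite -(zeros_perm a qpE).
  - rewrite -(perm_cons q); apply: (perm_trans _ pxy); rewrite perm_sym.
    exact: perm_trans pqE qpE.
- move=> x sx fx; have [w [sw w0 xw]] := toregular x sx fx.
  have [w' [sw' w'0 zw' ww']] := zerob w sw w0; exists (solve a 0 w').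
  rewrite /= sw' inE zw' orbT; split=> //; first by rewrite /zeros solveP ?eqxx.
  exact: linked_trans xw (linked_solve (a := a) ww').
- exists (map (solve a 0) rs); split=> [|x sx fx].
    apply/allP => _ /mapP[w wrs ->]; have /andP[/eqP sw w0] := allP rsP w wrs.
    by rewrite /= sw eqxx /zeros solveP ?eqxx.
  have [w [sw w0 xw]] := toregular x sx fx; have [w' wrs ww'] := rs_cover w sw w0.
  exists (solve a 0 w'); first exact: map_f.
  exact: linked_trans xw (linked_solve (a := a) ww').
Qed.

Lemma eq_tame m P Q : P =1 Q -> tame m P -> tame m Q.
Proof. by move=> PQ; rewrite -(funext PQ). Qed.

(** The level moves along the segment from c to c', which avoids 0. *)
Lemma linked_level m a c c' w : size w = m -> symlin (behead a) w != 0 ->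
  0 < c * c' -> linked m.+1 (nonzeros a) (solve a c w) (solve a c' w).
Proof.
move=> sw w0 cc'; pose p := c%:P + 'X * (c' - c)%:P.
have p0 : p.[0] = c by rewrite /p hornerD hornerM hornerX !hornerC mul0r addr0.
have p1 : p.[1] = c' by rewrite /p hornerD hornerM hornerX !hornerC mul1r addrC subrK.
rewrite -{1}p0 -{1}p1.
apply: (linked_curve (gam := fun t => solve a p.[t] w)) => [|t /andP[t0 t1]].
  by apply: curve_solve; rewrite -?sw; [exact: curve_cst|exact: regular_horner|].
rewrite /nonzeros solveP // /p hornerD hornerM hornerX !hornerC.
have c'0 : 0 < c' ^+ 2.
  by rewrite exprn_even_gt0 //=; apply: contraTneq cc' => ->; rewrite mulr0 ltxx.
suff : 0 < (c + t * (c' - c)) * c'.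
  by apply: contraTneq => ->; rewrite mul0r ltxx.
have -> : (c + t * (c' - c)) * c' = (1 - t) * (c * c') + t * c' ^+ 2 by ring.
move: t0; rewrite le_eqVlt => /predU1P[<-|t0].
  by rewrite subr0 mul1r mul0r addr0.
apply: ltr_wpDl; last exact: mulr_gt0.
by apply: mulr_ge0; [rewrite subr_ge0|exact: ltW].
Qed.

(** A point x of the open set lies on the level set of value symlin a x, that is
the zero set for the constant coefficient c - symlin a x; the derived
coefficients are the same for all the levels.  So each component contains
the graph, at level 1 or -1, over a component of {symlin (behead a) <> 0}. *)
Lemma tame_nonzeros m a : last 0 a != 0 -> (size a < m)%N ->
  tame m (nonzeros a).
Proof.
elim: a m => [|c b IH] m; first by rewrite eqxx.
case: b IH => [_ /= c0 m1|d b IH nz bm].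
  apply: (@eq_tame _ predT); last by apply: tame_predT; case: (m) m1.
  by move=> x; rewrite /nonzeros symlin1 c0.
case: m bm => [|[|k]] // bm; set a := [:: c, d & b].
have bk : (size (d :: b) <= k)%N by [].
have tameb : tame k.+1 (nonzeros (d :: b)) by apply: IH.
pose lev e := [:: c - e, d & b].
have levE e x : symlin (lev e) x = symlin a x - e.
  by rewrite symlin_const [symlin a x]symlin_const; ring.
have zeros_lev x : zeros (lev (symlin a x)) x by rewrite /zeros levE subrr.
have lev_sub e : e != 0 -> {subset zeros (lev e) <= nonzeros a}.
  move=> e0 x; rewrite !unfold_in /zeros /nonzeros levE subr_eq0.
  by move=> /eqP ->.
have tame_lev e : tame k.+2 (zeros (lev e)) :=
  tame_zeros (b := d :: b) (c - e) nz bk tameb.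
split.
- move=> x y sx x0 xy; apply: linked_sub (lev_sub _ x0) _.
  by have [+ _ _] := tame_lev (symlin a x); apply.
- move=> x sx x0; have [_ + _] := tame_lev (symlin a x).
  case/(_ x sx (zeros_lev x)) => y [sy fy y0 xy].
  exists y; split=> //; first exact: lev_sub x0 _ fy.
  exact: linked_sub (lev_sub _ x0) xy.
have [_ _ [rs [rsP rs_cover]]] := tameb.
exists ([seq solve a 1 w | w <- rs] ++ [seq solve a (-1) w | w <- rs]); split.
  by rewrite all_cat; apply/andP; split; apply/allP => _ /mapP[w wrs ->];
    have /andP[/eqP sw w0] := allP rsP w wrs;
    rewrite /= sw eqxx /nonzeros solveP // ?oppr_eq0 oner_eq0.
move=> x sx x0; set e := symlin a x in x0; have fx := zeros_lev x.
have [s [w [xw w0]]] := head_regular (b := d :: b) nz (leqW bk) sx (eqP fx).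
have [[sw] fw] := linked_in sx fx xw.
have [w' wrs ww'] := rs_cover w sw w0.
have [sw' w'0] := linked_in sw w0 ww'.
have L : linked k.+2 (nonzeros a) x (solve a e w').
  apply: linked_sub (lev_sub _ x0) _; apply: linked_trans xw _.
  have := linked_solve (a := lev e) ww'.
  rewrite -[X in solve _ X w](eqP fw) (solve_id (a := lev e)) //.
  by rewrite /solve levE opprB add0r.
have [e_gt0|] := ltrP 0 e.
  exists (solve a 1 w'); first by rewrite mem_cat map_f.
  by apply: linked_trans L _; apply: linked_level => //; rewrite mulr1.
rewrite le_eqVlt (negPf x0) /= => e_lt0.
exists (solve a (-1) w'); first by rewrite mem_cat orbC map_f.
by apply: linked_trans L _; apply: linked_level => //; rewrite mulrN1 oppr_gt0.
Qed.

(** Polynomials serve as coefficient lists whose last entry is nonzero. *)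
Lemma tame_zeros_poly (p : {poly R}) m : (size p < m)%N -> tame m (zeros p).
Proof.
case: p => [[|c [|d b]] /= nz] pm.
- apply: (@eq_tame _ predT); last exact: tame_predT.
  by move=> x; rewrite /zeros symlin_nil eqxx.
- apply: (@eq_tame _ pred0); last exact: tame_pred0.
  by move=> x; rewrite /zeros symlin1 (negPf nz).
case: m pm => [|[|k]] // pm; apply: (tame_zeros (b := d :: b) c) => //.
by apply: tame_nonzeros.
Qed.

End Tame.

(** * Finite dimensional rational vector spaces *)

Section Dimension.
Implicit Types U W : lmodType rat.

Definition has_dim U c :=
  exists2 g : 'rV[rat]_c -> U, linear g & bijective g.

Lemma linear_comp2 (U V W : lmodType rat) (f : V -> W) (g : U -> V) :
  linear f -> linear g -> linear (f \o g).
Proof. by move=> fl gl a u v /=; rewrite gl fl. Qed.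

Lemma linear_inverse U W (f : U -> W) g :
  linear f -> cancel f g -> cancel g f -> linear g.
Proof. by move=> fl fK gK a u v; rewrite -{1}(gK u) -{1}(gK v) -fl fK. Qed.

Lemma linear_0 U W (f : U -> W) : linear f -> f 0 = 0.
Proof. by move=> fl; have := fl (-1) 0 0; rewrite scaler0 addr0 scaleN1r addNr. Qed.

Lemma linear_inj0 U W (f : U -> W) : linear f ->
  (forall u, f u = 0 -> u = 0) -> injective f.
Proof.
move=> fl f0 u v fuv; apply/eqP; rewrite eq_sym -subr_eq0; apply/eqP/f0.
by rewrite addrC -scaleN1r fl scaleN1r fuv addNr.
Qed.

Lemma linear_inj_leq c k (f : 'rV[rat]_c -> 'rV[rat]_k) :
  linear f -> injective f -> (c <= k)%N.
Proof.
move=> fl fi.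
pose g : {linear 'rV[rat]_c -> 'rV[rat]_k} :=
  HB.pack f (GRing.isLinear.Build rat _ _ _ f fl).
have gE u : f u = u *m lin1_mx g by rewrite mul_rV_lin1.
suff : row_free (lin1_mx g).
  by rewrite -row_leq_rank => /leq_trans; apply; exact: rank_leq_col.
apply: inj_row_free => v; rewrite -gE => fv0; apply: fi.
by rewrite fv0 linear_0.
Qed.

Lemma inj_surj_bijective (A B : Type) (g : A -> B) :
  injective g -> (forall b, exists a, g a = b) -> bijective g.
Proof.
move=> gi /choice[h hK]; exists h => // a; apply: gi; exact: hK.
Qed.

(** A largest free family is a basis: a vector outside its span would extend
it. *)
Lemma has_dim_inj U k (f : U -> 'rV[rat]_k) : linear f -> injective f ->
  exists c, has_dim U c.
Proof.
move=> fl fi.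
pose P c := `[< exists2 g : 'rV[rat]_c -> U, linear g & injective g >].
have P0 : exists c, P c.
  exists 0%N; apply/asboolP; exists (fun=> 0).
    by move=> a u v; rewrite scaler0 addr0.
  by move=> u v _; rewrite [u]thinmx0 [v]thinmx0.
have Pk c : P c -> (c <= k)%N.
  move=> /asboolP[g gl gi].
  exact: linear_inj_leq (linear_comp2 fl gl) (inj_comp fi gi).
case: (ex_maxnP P0 Pk) => c /asboolP[g gl gi] cmax; exists c, g => //.
apply: inj_surj_bijective => // w; apply: contrapT => nw.
suff /cmax : P (c + 1)%N by rewrite addn1 ltnn.
pose ext (u : 'rV_(c + 1)) := rsubmx u 0 0 *: w + g (lsubmx u).
have extl : linear ext.
  move=> a u v; rewrite /ext !linearP /= gl scalerA addrACA -scalerDl mulrC.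
  by congr (_ *: _ + _); rewrite !mxE.
apply/asboolP; exists ext => //; apply: linear_inj0 => //.
move=> u; rewrite /ext; have [r0|r0 E] := eqVneq (rsubmx u 0 0) 0.
  rewrite r0 scale0r add0r -(linear_0 gl) => /gi l0.
  rewrite -[u]hsubmxK l0 -[RHS]row_mx0; congr row_mx.
  by apply/rowP => i; rewrite ord1 r0 mxE.
case: nw; exists (- (rsubmx u 0 0)^-1 *: lsubmx u).
rewrite -[_ *: _]addr0 gl linear_0 // addr0.
have -> : g (lsubmx u) = - (rsubmx u 0 0 *: w).
  by apply/eqP; rewrite -addr_eq0 addrC E.
by rewrite scalerN scaleNr opprK scalerA mulVf // scale1r.
Qed.

Lemma has_dim_leq U W c k (f : U -> W) : linear f -> injective f ->
  has_dim U c -> has_dim W k -> (c <= k)%N.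
Proof.
move=> fl fi [g gl /bij_inj gi] [h hl [h' hK h'K]].
apply: (@linear_inj_leq _ _ (h' \o (f \o g))).
  exact: linear_comp2 (linear_inverse hl hK h'K) (linear_comp2 fl gl).
exact: inj_comp (can_inj h'K) (inj_comp fi gi).
Qed.

Lemma has_dim_bij U W c (f : U -> W) : linear f -> bijective f ->
  has_dim U c -> has_dim W c.
Proof.
move=> fl fb [g gl gb]; exists (f \o g); first exact: linear_comp2.
exact: bij_comp.
Qed.

End Dimension.

(** * Specht modules and trivial modules *)

Section Tableaux.
Variables (n : nat) (nu : Defs.partn n).

Lemma part_leq i : (nth 0 (val nu) i <= n)%N.
Proof.
case: nu => s /= /andP[_ /eqP <-].
elim: s i => [|x s IH] [|i] //=; first exact: leq_addr.
exact: leq_trans (IH i) (leq_addl _ _).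
Qed.

Lemma size_part_leq : (size (val nu) <= n)%N.
Proof.
case: nu => s /= /andP[/andP[_ s0] /eqP <-].
elim: s s0 => //= x s IH; rewrite inE negb_or eq_sym -lt0n => /andP[x0 /IH].
by move=> ss; rewrite -add1n leq_add.
Qed.

Lemma part_gt0 i : (i < size (val nu))%N -> (0 < nth 0 (val nu) i)%N.
Proof.
case: nu => s /= /andP[/andP[_ s0] _] si.
by rewrite lt0n; apply: contraNneq s0 => <-; exact: mem_nth.
Qed.

(** The diagram of nu has n cells, so that its enumeration is a tableau. *)
Lemma tableau_exists : exists2 t : tableau n, is_tableau nu t &
  forall p : 'I_n * 'I_n, (p.2 < nth 0 (val nu) p.1)%N -> exists e, t e = p.
Proof.
pose cells := [set p : 'I_n * 'I_n | p.2 < nth 0 (val nu) p.1]%N%SET.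
have cells_card : #|cells| = n.
  rewrite -sum1_card.
  under eq_bigl do rewrite inE.
  rewrite -(pair_big_dep predT (fun i j : 'I_n => j < nth 0 (val nu) i)%N
             (fun _ _ => 1%N)) /=.
  have -> : \sum_(i < n) \sum_(j < n | (j < nth 0 (val nu) i)%N) 1%N =
            \sum_(i < n) nth 0 (val nu) i.
    apply: eq_bigr => i _.
    by rewrite -(big_ord_widen _ (fun=> 1%N)) ?part_leq // sum1_card card_ord.
  rewrite -[RHS](eqP (proj2 (andP (valP nu)))) sumnE (big_nth 0%N) big_mkord.
  rewrite [RHS](big_ord_widen n) ?size_part_leq // big_mkcond /=.
  rewrite [RHS]big_mkcond; apply: eq_bigr => i _.
  by case: ltnP => // /(nth_default 0%N).
pose t : tableau n := [ffun e => enum_val (cast_ord (esym cells_card) e)].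
exists t => [|p pc]; first (apply/andP; split).
- by apply/injectiveP => e e'; rewrite !ffunE => /enum_val_inj/cast_ord_inj.
- apply/forallP => e; rewrite ffunE.
  by have := enum_valP (cast_ord (esym cells_card) e); rewrite inE.
have pcells : p \in cells by rewrite inE.
exists (cast_ord cells_card (enum_rank_in pcells p)).
by rewrite ffunE cast_ordK enum_rankK_in.
Qed.

(** A permutation that preserves both the rows and the columns of a tableau is
the identity, so that the tabloid of t occurs with the coefficient 1. *)
Lemma polytabloid_neq0 t : is_tableau nu t -> polytabloid t != 0.
Proof.
case/andP=> /injectiveP ti _; set r := tableau_tabloid t.
suff E : polytabloid t r = 1.
  by apply/eqP => P0; move: E; rewrite P0 ffunE => /esym/eqP; rewrite oner_eq0.
have id_stab : 1%g \in column_stab t.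
  by rewrite inE; apply/forallP => e; rewrite perm1.
rewrite /polytabloid sum_ffunE (bigD1 1%g) //= big1 => [|s /andP[st s1]].
  by rewrite odd_perm1 scale1r tabloid_act1 ffunE eqxx addr0.
rewrite ffunE tabloid_act_vec ffunE; case: eqP => [rs|_]; last by rewrite scaler0.
case/eqP: s1; apply/permP => e; rewrite perm1; apply: ti.
move: st; rewrite inE => /forallP/(_ e)/eqP.
have := congr1 (fun f : tabloid n => f e) rs; rewrite !ffunE.
by case: (t e) (t (s e)) => ? ? [? ?] /= -> ->.
Qed.

Lemma column_transposition (t : tableau n) e0 e1 : e0 != e1 -> (t e0).2 = (t e1).2 ->
  tabloid_act (tperm e0 e1) (polytabloid t) = - polytabloid t.
Proof.
move=> e01 te; set s := tperm e0 e1.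
have ts e : (t (s e)).2 = (t e).2 by rewrite /s; case: tpermP => // ->.
rewrite /polytabloid raddf_sum /= -sumrN.
rewrite [RHS](reindex_inj (mulgI s)) /=; apply: eq_big => [u|u _].
  rewrite !inE; apply/forallP/forallP => ut e; first by rewrite permM (eqP (ut _)) ts.
  by have := ut (s e); rewrite permM tpermK ts.
by rewrite linearZ /= -tabloid_actM odd_permM odd_tperm e01 addTb signrN scaleNr opprK.
Qed.

Hypothesis n_gt0 : (0 < n)%N.

(** Such a shape has two cells in its first column, and exchanging their entries
negates a nonzero vector. *)
Lemma specht_nontrivial : val nu != [:: n] ->
  exists s, exists2 v, v \in specht nu & tabloid_act s v != v.
Proof.
move=> nun; have nu2 : (1 < size (val nu))%N.
  have := proj2 (andP (valP nu)).
  case: (val nu) nun => [|a [|b l]] //=.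
    by rewrite eq_sym -[_ == _]negbK -lt0n n_gt0.
  by rewrite addn0 => + /eqP E; rewrite E eqxx.
have n2 := leq_trans nu2 size_part_leq.
have [t tt tcells] := tableau_exists.
have [e0 te0] := tcells (Ordinal n_gt0, Ordinal n_gt0) (part_gt0 (ltnW nu2)).
have [e1 te1] := tcells (Ordinal n2, Ordinal n_gt0) (part_gt0 nu2).
exists (tperm e0 e1), (polytabloid t).
  by apply: memv_span; apply: map_f; rewrite mem_enum.
rewrite column_transposition ?te0 ?te1 //; last first.
  by apply/eqP => e01; move: te0; rewrite e01 te1 => -[].
rewrite -subr_eq0 -opprD oppr_eq0 -mulr2n -scaler_nat scaler_eq0 pnatr_eq0 /=.
exact: polytabloid_neq0.
Qed.

Definition row_tabloid : tabloid n := [ffun=> Ordinal n_gt0].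

(** With a single row, the column stabilizer is trivial and all the tableaux
have the same tabloid. *)
Lemma specht_row : val nu = [:: n] -> specht nu = <[tabloid_vec row_tabloid]>%VS.
Proof.
move=> nun.
have polyE t : is_tableau nu t -> polytabloid t = tabloid_vec row_tabloid.
  case/andP=> /injectiveP ti /forallP tc.
  have t0 e : (t e).1 = Ordinal n_gt0.
    apply: val_inj => /=; move: (tc e); rewrite nun.
    by case: (t e).1 => -[|k] //= _; rewrite nth_nil.
  have tE : tableau_tabloid t = row_tabloid by apply/ffunP => e; rewrite !ffunE t0.
  rewrite /polytabloid (big_pred1 1%g) => [|s].
    by rewrite odd_perm1 scale1r tabloid_act1 tE.
  rewrite inE; apply/forallP/eqP => [st|-> e]; last by rewrite perm1.
  apply/permP => e; rewrite perm1; apply: ti; move: (eqP (st e)) (t0 e) (t0 (s e)).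
  by case: (t e) (t (s e)) => ? ? [? ?] /= -> -> ->.
apply/eqP; rewrite eqEsubv; apply/andP; split.
  apply/span_subvP => _ /mapP[t tt ->]; rewrite polyE ?memv_line //.
  by move: tt; rewrite mem_enum.
have [t tt _] := tableau_exists.
rewrite -memvE -(polyE t tt); apply: memv_span; apply: map_f.
by rewrite mem_enum.
Qed.

End Tableaux.

Section Multiplicity.
Variables (n : nat) (n_gt0 : (0 < n)%N).
Implicit Types (nu mu : Defs.partn n) (m : Defs.partn n -> nat).
Local Notation r0 := (row_tabloid n_gt0).

Fact row_partP : is_partition [:: n] && (sumn [:: n] == n).
Proof. by rewrite /is_partition /= inE addn0 eqxx eq_sym -lt0n n_gt0. Qed.

Definition row_part : Defs.partn n := exist _ [:: n] row_partP.

Lemma row_partE nu : val nu = [:: n] -> nu = row_part.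
Proof. by move=> nun; apply: val_inj. Qed.

Lemma mem_specht_row v : (v \in specht row_part) = (v == v r0 *: tabloid_vec r0).
Proof.
rewrite (specht_row n_gt0) //; apply/vlineP/eqP => [[k ->]|->]; last by eexists.
by rewrite ffunE [tabloid_vec _ _]ffunE eqxx [_ *: 1]mulr1.
Qed.

Definition specht_sum_of m (v : familyModule m)
    (vP : forall x, v x \in specht (tag x)) : specht_sum m :=
  @SubSort n _ (SnSubmodule (@specht_sum0 n m) (@specht_sumP n m)
                            (@specht_sum_act n m)) v (asboolT vP).

Lemma specht_sum_row m : (forall nu, val nu != [:: n] -> m nu = 0%N) ->
  has_dim (specht_sum m) (m row_part) /\
  forall s (v : specht_sum m), snm_act s v = v.
Proof.
move=> m0.
have tag_row (x : {nu & 'I_(m nu)}) : tag x = row_part.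
  apply: row_partE; apply/eqP; apply: contraT => /m0 E.
  by have := ltn_ord (tagged x); rewrite {2}E.
have rowE (v : specht_sum m) x : sub_val v x = sub_val v x r0 *: tabloid_vec r0.
  apply/eqP; rewrite -mem_specht_row -(tag_row x).
  by have /asboolP := sub_valP v; apply.
split; last first.
  move=> s v; apply: val_inj; apply/funext => x /=.
  rewrite /family_act rowE linearZ /= tabloid_act_vec; congr (_ *: tabloid_vec _).
  by apply/ffunP => e; rewrite !ffunE.
(* The coordinates of u are indexed by 'I_(m row_part), while the index type
   of x depends on tag x; comparing the underlying numbers in a sum
   avoids transporting along [tag_row]. *)
pose coef (u : 'rV[rat]_(m row_part)) (x : {nu & 'I_(m nu)}) : rat :=
  \sum_(i < m row_part | i == tagged x :> nat) u 0 i.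
pose fam u : familyModule m := fun x => coef u x *: tabloid_vec r0.
have famP u x : fam u x \in specht (tag x).
  rewrite /fam memvZ // tag_row mem_specht_row.
  by rewrite [tabloid_vec _ _]ffunE eqxx scale1r.
pose h u : specht_sum m := specht_sum_of (famP u).
have hl : linear h.
  move=> a u v; apply: val_inj; apply/funext => x /=.
  rewrite /fam -[RHS]/(a *: (coef u x *: tabloid_vec r0) +
    coef v x *: tabloid_vec r0).
  rewrite scalerA -scalerDl; congr (_ *: _).
  rewrite /coef mulr_sumr -big_split; apply: eq_bigr => i _.
  by rewrite !mxE.
exists h => //; exists (fun v : specht_sum m =>
    \row_i sub_val v (Tagged (fun nu => 'I_(m nu)) i) r0).
  move=> u; apply/rowP => i; rewrite mxE /= /fam ffunE [tabloid_vec _ _]ffunE eqxx.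
  by rewrite [_ *: 1]mulr1 /coef (big_pred1 i) //.
move=> v; apply: val_inj; apply/funext => x; rewrite [RHS]rowE /= /fam.
congr (_ *: _); case: x (tag_row x) => nu i /= nuE; rewrite nuE in i *.
by rewrite /coef (big_pred1 i) //= mxE.
Qed.

(** In any decomposition of M, the modules [specht nu] on which some permutation
acts nontrivially are excluded, and the others have dimension 1. *)
Lemma trivial_multiplicity (M : snModule n) c mu :
  (forall s (v : M), snm_act s v = v) -> has_dim M c ->
  is_multiplicity M mu (if val mu == [:: n] then c else 0%N).
Proof.
move=> Mtriv Mc; split.
  pose m nu := if val nu == [:: n] then c else 0%N.
  exists m; split=> //.
  have [|[h hl [h' hK h'K]] htriv] := @specht_sum_row m.
    by move=> nu; rewrite /m => /negPf ->.
  have mc : c = m row_part by rewrite /m /= eqxx.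
  move: Mc; rewrite mc => -[g gl [g' gK g'K]].
  pose f := h \o g'.
  have fl : linear f by apply: linear_comp2 hl (linear_inverse gl gK g'K).
  pose F : {linear M -> specht_sum m} :=
    HB.pack f (GRing.isLinear.Build rat _ _ _ f fl).
  exists F; split=> [|s v]; last by rewrite Mtriv htriv.
  by apply: (@bij_comp _ _ _ h g'); [exists h'|exists g].
move=> m [f [fb fact]].
have triv s (v : specht_sum m) : snm_act s v = v.
  by have [f' fK f'K] := fb; rewrite -(f'K v) -fact Mtriv.
have m0 nu : val nu != [:: n] -> m nu = 0%N.
  move=> /(specht_nontrivial n_gt0)[s [v vs]] sv; apply/eqP; apply: contraNT sv.
  rewrite -lt0n => m_gt0; pose fam : familyModule m :=
    fun x => if tag x == nu then v else 0.
  have famP x : fam x \in specht (tag x).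
    by rewrite /fam; case: eqP => [->|_] //; exact: mem0v.
  pose x := Tagged (fun nu => 'I_(m nu)) (Ordinal m_gt0).
  have := congr1 (fun w : specht_sum m => sub_val w x) (triv s (specht_sum_of famP)).
  move=> /=.
  by rewrite /family_act /fam eqxx => ->.
have [[h hl [h' hK h'K]] _] := specht_sum_row m0.
case: ifPn => [/eqP/row_partE ->|/m0//].
have [g gl [g' gK g'K]] := has_dim_bij (fun a u v => linearP f a u v) fb Mc.
apply/eqP; rewrite eqn_leq; apply/andP; split.
  apply: (linear_inj_leq (linear_comp2 (linear_inverse gl gK g'K) hl)).
  by apply: inj_comp; [exact: can_inj g'K|exact: can_inj hK].
apply: (linear_inj_leq (linear_comp2 (linear_inverse hl hK h'K) gl)).
by apply: inj_comp; [exact: can_inj h'K|exact: can_inj gK].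
Qed.

End Multiplicity.

(** * Comparison with elementary symmetric polynomials *)

Section Elementary.
Variable R : rcfType.

(** The e_k are the coefficients of the product of the 1 + y X. *)
Lemma symlin_coef (a x : seq R) K : (size a <= K)%N ->
  symlin a x = \sum_(k < K) a`_k * (\prod_(y <- x) (1 + y *: 'X))`_k.
Proof.
elim: x a K => [|y x IH] a K aK /=.
  rewrite big_nil; case: K aK => [|K] aK.
    by move: aK; case: (a); rewrite // big_ord0.
  rewrite big_ord_recl /= coef1 mulr1 big1 ?addr0 ?nth0 // => i _.
  by rewrite coef1 mulr0.
rewrite big_cons (IH a K.+1) ?(leqW aK) // (IH (behead a) K); last first.
  by rewrite size_behead (leq_trans (leq_pred _)).
set E : {poly R} := \prod_(_ <- x) _.
have cE k : ((1 + y *: 'X) * E)`_k = E`_k + y * (if k is k'.+1 then E`_k' else 0).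
  by rewrite mulrDl mul1r coefD -scalerAl coefZ coefXM; case: k.
transitivity (\sum_(k < K.+1) a`_k * ((1 + y *: 'X) * E)`_k); last first.
  by rewrite big_ord_recr /= [a`_K]nth_default // mul0r addr0.
rewrite [RHS](eq_bigr (fun k : 'I_K.+1 => a`_k * E`_k +
    a`_k * (y * (if nat_of_ord k is k'.+1 then E`_k' else 0)))); last first.
  by move=> k _; rewrite cE mulrDr.
rewrite big_split /=; congr (_ + _).
rewrite big_ord_recl /= !mulr0 add0r mulr_sumr; apply: eq_bigr => k _.
by rewrite nth_behead /= mulrCA.
Qed.

Lemma symlin_mesym n (p : seq R) d (v : 'I_n -> R) : (size p <= d)%N ->
  \sum_(k < d) p`_k * (mesym n R k).@[v] = symlin p [seq v i | i <- enum 'I_n].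
Proof.
move=> pd; rewrite (symlin_coef _ pd); apply: eq_bigr => k _; congr (_ * _).
rewrite big_map big_enum /=; under [in RHS]eq_bigr do rewrite addrC.
rewrite bigA_distr coef_sum /mesym raddf_sum big_mkcond /=.
apply: eq_big => [h|h _]; first by rewrite inE.
rewrite -big_mkcond /= scaler_prod prodr_const coefZ coefXn eq_sym.
case: eqP => _; last by rewrite mulr0.
by rewrite mulr1 rmorph_prod /=; apply: eq_bigr => i _; rewrite mevalXU.
Qed.

End Elementary.

(** * Semialgebraic simplices from rational curves *)

Local Open Scope classical_set_scope.

Section Semialgebraic.
Variables (R : rcfType) (n : nat).
Implicit Types (p : {mpoly R[n]}) (A B : set 'rV[R]_n).

Lemma sa_cap A B : semialgebraic A -> semialgebraic B -> semialgebraic (A `&` B).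
Proof.
move=> sA sB; apply: sa_ext (sa_compl (sa_union (sa_compl sA) (sa_compl sB))).
by rewrite setCU !setCK.
Qed.

Lemma sa_ge0 p : semialgebraic [set x | 0 <= p.@[x 0]].
Proof.
apply: sa_ext (sa_compl (sa_pos (- p))); apply/seteqP.
by split=> x /=; rewrite mevalN oppr_gt0 leNgt => /negP.
Qed.

Lemma sa_eq0 p : semialgebraic [set x | p.@[x 0] = 0].
Proof.
apply: sa_ext (sa_cap (sa_ge0 p) (sa_ge0 (- p))); apply/seteqP.
split=> x /=; rewrite mevalN oppr_ge0; last by move=> ->.
by case=> ? ?; apply/eqP; rewrite eq_le; apply/andP.
Qed.

Lemma sa_all_eq0 k (q : 'I_k -> {mpoly R[n]}) :
  semialgebraic [set x | forall i, (q i).@[x 0] = 0].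
Proof.
elim: k q => [|k IH] q.
  by apply: sa_ext (sa_eq0 0); apply/seteqP; split=> x /=; rewrite ?meval0 // => _ [].
apply: sa_ext (sa_cap (sa_eq0 (q ord0)) (IH (fun i => q (lift ord0 i)))).
apply/seteqP; split=> x /= => [[q0 qS] i|qx]; last by split.
by case: (unliftP ord0 i) => [j|] ->.
Qed.

End Semialgebraic.

Section Rational.
Variable R : rcfType.

(** With f = N / D, the difference f u - f t is (P u - P t) / (D u * D t) for
the polynomial P = D t * N - N t * D; continuity of D bounds the denominator from
below. *)
Lemma regular_continuous (f : R -> R) (t e : R) : regular f -> 0 <= t <= 1 -> 0 < e ->
  exists2 d, 0 < d & forall u, 0 <= u <= 1 -> `|u - t| < d -> `|f u - f t| < e.
Proof.
move=> [N [D ND]] t01 e0; have [Dt ft] := ND t t01.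
have Dt0 : 0 < `|D.[t]| by rewrite normr_gt0.
pose P := D.[t] *: N - N.[t] *: D.
have [d1 d10 d1P] := poly_cont t D (divr_gt0 Dt0 (ltr0Sn R 1)).
have e'0 : 0 < e * (`|D.[t]| ^+ 2 / 2) by rewrite mulr_gt0 // divr_gt0 ?exprn_gt0.
have [d2 d20 d2P] := poly_cont t P e'0.
exists (Num.min d1 d2); first by rewrite lt_min d10.
move=> u u01; rewrite lt_min => /andP[/d1P Du /d2P Pu]; have [Du0 fu] := ND u u01.
have Duge : `|D.[t]| / 2 < `|D.[u]|.
  have := ler_normD D.[u] (D.[t] - D.[u]); rewrite addrC subrK distrC.
  by move: Du; lra.
have -> : f u - f t = (P.[u] - P.[t]) / (D.[u] * D.[t]).
  by rewrite fu ft /P !hornerE; field; rewrite Dt Du0.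
rewrite normrM normfV ltr_pdivrMr; last by rewrite normr_gt0 mulf_neq0.
apply: lt_trans Pu _; rewrite ltr_pM2l // normrM.
by rewrite expr2 mulrAC ltr_pM2r.
Qed.

Lemma min_radius k (d : 'I_k -> R) : (forall i, 0 < d i) ->
  exists2 r, 0 < r & forall i, r <= d i.
Proof.
move=> d0; exists (\big[Num.min/1]_i d i); last by move=> i; exact: bigmin_le.
by apply/bigmin_gtP; split=> // i _; exact: d0.
Qed.

End Rational.

Section Points.
Variables (R : rcfType) (n : nat).
Implicit Types (S : set 'rV[R]_n) (x : 'rV[R]_n) (s : seq R).

Definition coords x : seq R := [seq x 0 i | i <- enum 'I_n].
Definition point_of s : 'rV[R]_n := \row_i s`_i.

Lemma size_coords x : size (coords x) = n.
Proof. by rewrite size_map size_enum_ord. Qed.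

Lemma coordsK x : point_of (coords x) = x.
Proof. by apply/rowP => i; rewrite mxE (nth_map i) ?size_enum_ord // nth_ord_enum. Qed.

Lemma point_ofK s : size s = n -> coords (point_of s) = s.
Proof.
move=> sn; apply: (@eq_from_nth _ 0); rewrite size_coords // => i ni.
rewrite (nth_map (Ordinal ni)) ?size_enum_ord // mxE.
by rewrite (nth_ord_enum _ (Ordinal ni)).
Qed.

Lemma coords_perm (sg : 'S_n) x : perm_eq (coords (col_perm sg x)) (coords x).
Proof.
have -> : coords (col_perm sg x) = [seq x 0 i | i <- [seq sg i | i <- enum 'I_n]].
  by rewrite -map_comp; apply: eq_map => i; rewrite /= mxE.
apply: perm_map; apply: uniq_perm.
- by rewrite map_inj_uniq ?enum_uniq //; exact: perm_inj.
- exact: enum_uniq.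
- move=> i; rewrite mem_enum; apply/mapP; exists (sg^-1%g i); rewrite ?mem_enum //.
  by rewrite permKV.
Qed.

Lemma stdsimplex0_eq (t : stdsimplex R 0) : val t = 1.
Proof.
apply/matrixP => i j; rewrite !ord1 mxE; case/andP: (valP t) => _.
by rewrite big_ord1 => /eqP.
Qed.

Fact vertexP : is_simplex_point (1 : 'rV[R]_1).
Proof.
apply/andP; split; last by rewrite big_ord1 mxE.
by apply/forallP => i; rewrite ord1 mxE ler01.
Qed.
Definition vertex : stdsimplex R 0 := exist _ 1 vertexP.

Lemma vertexE t : t = vertex.
Proof. by apply: val_inj; exact: stdsimplex0_eq. Qed.

Section Point.
Variables (S : set 'rV[R]_n) (x : 'rV[R]_n) (Sx : S x).

Fact point_continuous : continuous_simplex (fun _ : stdsimplex R 0 => x).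
Proof.
by move=> t e e0; exists 1; rewrite ?ltr01 // => u _ j; rewrite subrr normr0.
Qed.

Fact point_sa : semialgebraic (graph_simplex (fun _ : stdsimplex R 0 => x)).
Proof.
pose z0 := row_mx (1 : 'rV[R]_1) x.
apply: sa_ext (sa_all_eq0 (fun i : 'I_(1 + n) => 'X_i - (z0 0 i)%:MP)).
apply/seteqP; split=> [z /= zE|_ [t _ <-] i]; last first.
  by rewrite mevalB mevalXU mevalC stdsimplex0_eq subrr.
exists vertex => //; apply/rowP => i; have := zE i.
by rewrite mevalB mevalXU mevalC => /eqP; rewrite subr_eq0 => /eqP ->.
Qed.

Definition point : simplex S 0 :=
  @Simplex R n S 0 (fun=> x) (fun=> Sx) point_continuous point_sa.

End Point.

Lemma simplex0_point S (f : simplex S 0) : f = point (simplex_in f vertex).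
Proof. by apply: simplexP => t /=; rewrite (vertexE t). Qed.

End Points.

Section Segment.
Variable R : rcfType.

Lemma simplex1_pointE (t : 'rV[R]_2) : is_simplex_point t =
  [&& 0 <= t 0 ord0, 0 <= t 0 ord_max & t 0 ord0 + t 0 ord_max == 1].
Proof.
have e0 : widen_ord (leqnSn 1) ord0 = ord0 by exact: val_inj.
rewrite /is_simplex_point big_ord_recr big_ord1 /= e0 andbA; congr (_ && _).
apply/forallP/andP => [t0|[t0 t1] i]; first by split; exact: t0.
case: (unliftP ord_max i) => [k|] -> //.
by rewrite ord1 (_ : lift _ _ = ord0) //; exact: val_inj.
Qed.

Lemma stdsimplex1_itv (t : stdsimplex R 1) : 0 <= val t 0 ord_max <= 1.
Proof.
have := valP t; rewrite simplex1_pointE => /and3P[t0 -> /eqP <-] /=.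
by rewrite lerDr.
Qed.

End Segment.

Section Arc.
Variables (R : rcfType) (n : nat) (S : set 'rV[R]_n) (gam : R -> seq R).
Hypothesis gam_curve : curve n gam.
Hypothesis gamS : forall t : R, 0 <= t <= 1 -> S (point_of n (gam t)).

Definition arc_fun (t : stdsimplex R 1) : 'rV[R]_n :=
  point_of n (gam (val t 0 ord_max)).

Fact arc_in t : S (arc_fun t).
Proof. by apply: gamS; exact: stdsimplex1_itv. Qed.

Fact arc_continuous : continuous_simplex arc_fun.
Proof.
move=> t e e0; have [_ rg] := gam_curve.
have /choice[d dP] (j : 'I_n) : exists d, 0 < d /\ forall u : R, 0 <= u <= 1 ->
    `|u - val t 0 ord_max| < d -> `|(gam u)`_j - (gam (val t 0 ord_max))`_j| < e.
  have [d d0 dP] := regular_continuous (rg j) (stdsimplex1_itv t) e0.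
  by exists d.
have [r r0 rd] := min_radius (fun j => (dP j).1).
exists r => // u ut j; rewrite !mxE; apply: (dP j).2 (stdsimplex1_itv u) _.
exact: lt_le_trans (ut _) (rd j).
Qed.

(** With z = (t0, t1, x), the graph is cut out by t0, t1 >= 0, t0 + t1 = 1 and
x_j * D_j t1 = N_j t1. *)
Fact arc_sa : semialgebraic (graph_simplex arc_fun).
Proof.
have [_ rg] := gam_curve.
have /choice[ND NDP] (j : 'I_n) : exists ND : {poly R} * {poly R},
    forall t : R, 0 <= t <= 1 -> ND.2.[t] != 0 /\ (gam t)`_j = ND.1.[t] / ND.2.[t].
  by have [N [D ND]] := rg j; exists (N, D).
pose T : {mpoly R[2 + n]} := 'X_(lshift n ord_max).
pose T0 : {mpoly R[2 + n]} := 'X_(lshift n ord0).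
pose at_T (p : {poly R}) := (map_poly (@mpolyC _ R) p).[T].
have at_TE p (z : 'rV[R]_(2 + n)) : (at_T p).@[z 0] = p.[lsubmx z 0 ord_max].
  rewrite /at_T -horner_map /= mevalXU mxE -map_poly_comp; congr _.[_].
  by rewrite map_poly_id // => c _ /=; rewrite mevalC.
pose q (j : 'I_n) := at_T (ND j).2 * 'X_(rshift 2 j) - at_T (ND j).1.
apply: sa_ext (sa_cap (sa_cap (sa_ge0 T0) (sa_ge0 T))
                      (sa_cap (sa_eq0 (T0 + T - 1)) (sa_all_eq0 q))).
have qE (z : 'rV[R]_(2 + n)) j : (q j).@[z 0] =
    (ND j).2.[lsubmx z 0 ord_max] * rsubmx z 0 j - (ND j).1.[lsubmx z 0 ord_max].
  by rewrite mevalB mevalM !at_TE mevalXU [rsubmx _ _ _]mxE.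
have TE (z : 'rV[R]_(2 + n)) : T.@[z 0] = lsubmx z 0 ord_max.
  by rewrite mevalXU mxE.
have T0E (z : 'rV[R]_(2 + n)) : T0.@[z 0] = lsubmx z 0 ord0.
  by rewrite mevalXU mxE.
apply/seteqP; split=> [z /= [[z0 z1] [z01 zq]]|_ [t _ <-]]; last first.
  have t01 := stdsimplex1_itv t; have := valP t.
  rewrite simplex1_pointE => /and3P[t0 t1 /eqP t_sum].
  rewrite /= mevalB mevalD meval1 T0E TE row_mxKl t_sum subrr; do !split=> //.
  move=> j; rewrite qE row_mxKl row_mxKr mxE.
  by have [D0 ->] := NDP j _ t01; rewrite mulrC divfK // subrr.
move: z0 z1 z01; rewrite mevalB mevalD meval1 T0E TE => z0 z1 /eqP.
rewrite subr_eq0 => z01.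
have zP : is_simplex_point (lsubmx z) by rewrite simplex1_pointE z0 z1.
exists (exist _ (lsubmx z) zP) => //=; rewrite -[RHS]hsubmxK; congr row_mx.
apply/rowP => j; rewrite mxE /=.
have [D0 ->] := NDP j _ (stdsimplex1_itv (exist _ (lsubmx z) zP)).
have /eqP := zq j; rewrite qE subr_eq0 => /eqP <-.
by rewrite mulrC mulKf.
Qed.

Definition arc : simplex S 1 := Simplex arc_in arc_continuous arc_sa.

Lemma arc_face0 (S1 : S (point_of n (gam 1))) : simplex_face ord0 arc = point S1.
Proof.
apply: simplexP => t /=; rewrite /arc_fun /= mxE (vertexE t) /=.
case: (unliftP ord0 ord_max) => [k _|//]; by rewrite ord1 mxE eqxx.
Qed.

Lemma arc_face1 (S0 : S (point_of n (gam 0))) : simplex_face ord_max arc = point S0.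
Proof. by apply: simplexP => t /=; rewrite /arc_fun /= mxE unlift_none. Qed.

End Arc.

(** Adding a zero coordinate in front maps the zero set in n variables into the
one in n + 1 variables. *)
Section PushForward.
Variables (R : rcfType) (n : nat) (S : set 'rV[R]_n) (S' : set 'rV[R]_n.+1).
Hypothesis SS' : forall x, S x -> S' (row_mx (0 : 'rV_1) x).
Variables (p : nat) (f : simplex S p).

Fact push_in t : S' (row_mx (0 : 'rV_1) (f t)).
Proof. by apply: SS'; exact: simplex_in. Qed.

Fact push_continuous : continuous_simplex (fun t => row_mx (0 : 'rV_1) (f t)).
Proof.
move=> t e e0; have [d d0 fd] := simplex_continuous f t e0.
exists d => // u ut j; rewrite !mxE; case: fintype.splitP => k _; last exact: fd.
by rewrite !mxE subrr normr0.
Qed.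

Fact push_sa : semialgebraic (graph_simplex (fun t => row_mx (0 : 'rV_1) (f t))).
Proof.
pose q (j : 'I_(p.+1 + n)) : {mpoly R[p.+1 + (1 + n)]} :=
  match fintype.split j with
  | inl j => 'X_(lshift _ j)
  | inr j => 'X_(rshift p.+1 (rshift 1 j))
  end.
have qE (z : 'rV[R]_(p.+1 + (1 + n))) :
    \row_j (q j).@[z 0] = row_mx (lsubmx z) (rsubmx (rsubmx z)).
  apply/rowP => j; rewrite mxE /q mxE; case: fintype.splitP => k _;
  by rewrite mevalXU !mxE.
apply: sa_ext (sa_cap (sa_eq0 'X_(rshift p.+1 (lshift n ord0)))
                      (sa_preimage q (simplex_sa f))).
apply/seteqP; split=> [z /= [z0 [t _]]|_ [t _ <-]] /=; last first.
  rewrite qE row_mxKl row_mxKr row_mxKr mevalXU; split; last by exists t.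
  by rewrite row_mxEr row_mxEl mxE.
rewrite qE => /eq_row_mx[tz fz]; exists t => //.
rewrite -[RHS]hsubmxK -[rsubmx z]hsubmxK.
congr (row_mx _ (row_mx _ _)) => //.
by rewrite mevalXU in z0; apply/rowP => i; rewrite ord1 !mxE z0.
Qed.

Definition push : simplex S' p := Simplex push_in push_continuous push_sa.

End PushForward.

(** * Cocycles of degree 0 *)

Section ZeroCocycles.
Variable R : rcfType.

Definition cuts n (P : pred (seq R)) (S : symset R n) :=
  forall x, symset_set S x <-> P (coords x).

Section Value.
Variables (n : nat) (S : symset R n) (P : pred (seq R)).
Hypothesis SP : cuts P S.
Implicit Types (c : cocycles S 0) (x : 'rV[R]_n).

(** The extension by 0 to all points makes cocycles into functions on a type
that does not depend on the set S. *)
Definition value c x : rat :=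
  if pselect (symset_set S x) is left Sx then (sub_val c : cochain S 0) (point Sx)
  else 0.

Lemma value_point c x (Sx : symset_set S x) :
  (sub_val c : cochain S 0) (point Sx) = value c x.
Proof.
rewrite /value; case: pselect => // Sx'; congr (_ _); exact: simplexP.
Qed.

Lemma value_simplex c (f : simplex S 0) :
  (sub_val c : cochain S 0) f = value c (f (vertex R)).
Proof. by rewrite {1}(simplex0_point f) value_point. Qed.

Lemma value_linear x : linear (fun c => value c x : rat^o).
Proof.
move=> a c c'; rewrite /value; case: pselect => [Sx|_] //.
by rewrite scaler0 addr0.
Qed.

Lemma value_eq c c' : (forall x, symset_set S x -> value c x = value c' x) -> c = c'.
Proof.
move=> cc'; apply: val_inj; apply/funext => f /=; rewrite !value_simplex cc' //.
exact: simplex_in.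
Qed.

(** The cocycle condition for the 1-simplex of the curve. *)
Lemma value_curve c : curve_constant n P (fun s => value c (point_of n s)).
Proof.
move=> gam cg gP.
have gS t : 0 <= t <= 1 -> symset_set S (point_of n (gam t)).
  by move=> t01; apply/SP; rewrite point_ofK ?gP // cg.1.
have S0 : symset_set S (point_of n (gam 0)) by apply: gS; rewrite lexx ler01.
have S1 : symset_set S (point_of n (gam 1)) by apply: gS; rewrite lexx ler01.
have /asboolP := sub_valP c.
move/(congr1 (fun b : cochain S 1 => b (arc cg gS))).
rewrite /coboundary /= big_ord_recr big_ord1 /= expr0 expr1 mul1r mulN1r.
rewrite (_ : widen_ord _ _ = ord0); last exact: val_inj.
rewrite (arc_face0 cg gS S1) (arc_face1 cg gS S0) !value_point => /eqP.
by rewrite subr_eq0 => /eqP.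
Qed.

Lemma value_linked c x y : linked n P (coords x) (coords y) ->
  value c x = value c y.
Proof. by move=> /(_ _ (value_curve c)); rewrite !coordsK. Qed.

Hypothesis P_tame : tame n P.

Lemma cocycles_trivial s c : snm_act s c = c.
Proof.
apply: val_inj; apply/funext => f.
rewrite -[LHS]/((sub_val c : cochain S 0) (simplex_perm s^-1 f)).
rewrite -[RHS]/((sub_val c : cochain S 0) f) !value_simplex /=.
apply: value_linked; case: P_tame => P_perm _ _; apply: linked_sym.
apply: P_perm; first exact: size_coords.
  by apply/SP; exact: simplex_in.
by rewrite perm_sym; exact: coords_perm.
Qed.

(** A cocycle is determined by its values at representatives of
the components. *)
Lemma cocycles_has_dim : exists d, has_dim (cocycles S 0) d.
Proof.
have [_ _ [rs [rsP rs_cover]]] := P_tame.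
pose ev c : 'rV[rat]_(size rs) := \row_i value c (point_of n (nth [::] rs i)).
have evl : linear ev.
  by move=> a c c'; apply/rowP => i; rewrite !mxE value_linear.
apply: (has_dim_inj evl) => c c' cc'; apply: value_eq => x /SP Px.
have [y yrs xy] := rs_cover _ (size_coords x) Px.
have /andP[/eqP sy _] := allP rsP y yrs.
have value_y b : value b x = value b (point_of n y).
  by apply: value_linked; rewrite point_ofK.
have iy : (index y rs < size rs)%N by rewrite index_mem.
have := congr1 (fun u : 'rV_(size rs) => u 0 (Ordinal iy)) cc'.
by rewrite !mxE /= nth_index // -!value_y.
Qed.

End Value.

Section Restriction.
Variables (n : nat) (S : symset R n) (S' : symset R n.+1) (P : pred (seq R)).
Hypotheses (SP : cuts P S) (SP' : cuts P S').
Hypothesis P0 : forall s, P (0 :: s) = P s.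

Lemma coords_push (x : 'rV[R]_n) : coords (row_mx (0 : 'rV_1) x) = 0 :: coords x.
Proof.
rewrite /coords enum_ordSl /= -map_comp; congr (_ :: _).
  by rewrite (_ : ord0 = lshift n (ord0 : 'I_1)) ?row_mxEl ?mxE //; exact: val_inj.
apply: eq_map => i /=; rewrite -(row_mxEr (0 : 'rV_1) x 0 i); congr (row_mx _ _ _ _).
exact: val_inj.
Qed.

Lemma push_mem x : symset_set S x -> symset_set S' (row_mx (0 : 'rV_1) x).
Proof. by move=> /SP Px; apply/SP'; rewrite coords_push P0. Qed.

Fact pull_cocycleP (c : cocycles S' 0) :
  (fun f => (sub_val c : cochain S' 0) (push push_mem f)) \in @is_cocycle R n S 0.
Proof.
apply/asboolP/funext => f; have /asboolP dc := sub_valP c.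
apply: etrans (congr1 (fun b : cochain S' 1 => b (push push_mem f)) dc).
by apply: eq_bigr => i _; congr (_ * (sub_val c : cochain S' 0) _); exact: simplexP.
Qed.

Definition pull_cocycle (c : cocycles S' 0) : cocycles S 0 :=
  @SubSort n _ (SnSubmodule (@cocycle0 R n S 0) (@cocycleP R n S 0)
                            (@cocycle_act R n S 0)) _ (pull_cocycleP c).

Lemma pull_cocycle_linear : linear pull_cocycle.
Proof. by move=> a c c'; apply: val_inj; apply/funext => f. Qed.

Lemma value_pull c x : symset_set S x ->
  value (pull_cocycle c) x = value c (row_mx (0 : 'rV_1) x).
Proof.
move=> Sx; rewrite -(value_point _ Sx) -(value_point _ (push_mem Sx)) /=.
by congr ((sub_val c : cochain S' 0) _); exact: simplexP.
Qed.

(** Every point of S' is linked to one with a zero coordinate, hence to one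
whose zero coordinate comes first. *)
Lemma pull_cocycle_inj : tame n.+1 P -> injective pull_cocycle.
Proof.
move=> [P_perm P_zero _] c c' cc'; apply: value_eq => x /SP' Px.
have [y [sy Py y0 xy]] := P_zero _ (size_coords x) Px.
have yE := perm_to_rem y0; set z := rem 0 y in yE.
have sz : size z = n by have := perm_size yE; rewrite sy => -[].
have Pz : P z by rewrite -P0; have [_] := linked_in sy Py (P_perm _ _ sy Py yE).
have Sz : symset_set S (point_of n z) by apply/SP; rewrite point_ofK.
have value_z b : value b x = value (pull_cocycle b) (point_of n z).
  rewrite value_pull //; apply: (value_linked SP'); rewrite coords_push point_ofK //.
  exact: linked_trans xy (P_perm _ _ sy Py yE).
by rewrite !value_z cc'.
Qed.

End Restriction.

Section Cohomology0.
Variables (n : nat) (S : symset R n).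

Definition class0 (c : cocycles S 0) : cohomology S 0 :=
  (\pi_(cohomology S 0))%qT c.

Lemma class0_linear : linear class0.
Proof.
move=> a u v; rewrite /class0.
by rewrite (quot_piD (SnSubmodule (@coboundaries0 R n S 0) (@coboundariesP R n S 0)
                            (@coboundaries_act R n S 0))) quot_piZ.
Qed.

(** In degree 0 the only coboundary is 0. *)
Lemma class0_bijective : bijective class0.
Proof.
apply: inj_surj_bijective => [c c' /quot_eqP/asboolP E|h].
  apply/eqP; rewrite -subr_eq0; apply/eqP/val_inj; exact: E.
by exists (generic_quotient.repr h); exact: generic_quotient.reprK.
Qed.

Lemma cohomology0_trivial : (forall s (c : cocycles S 0), snm_act s c = c) ->
  forall s (h : cohomology S 0), snm_act s h = h.
Proof.
move=> triv s h; have [g _ gK] := class0_bijective; rewrite -(gK h).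
apply: etrans (_ : class0 (snm_act s (g h)) = _); last by rewrite triv.
by rewrite /class0 quot_pi_act.
Qed.

End Cohomology0.

(** The sequence is given by its graph P, as dimensions are. *)
Lemma nonincreasing_eventually_constant (P : nat -> nat -> Prop) N :
  (forall n, (N <= n)%N -> exists c, P n c) ->
  (forall n c c', (N <= n)%N -> P n c -> P n.+1 c' -> (c' <= c)%N) ->
  (forall n c c', P n c -> P n c' -> c = c') ->
  exists c M, (N <= M)%N /\ forall n, (M <= n)%N -> P n c.
Proof.
move=> P_ex P_dec P_uniq.
have [c Pc] := P_ex N (leqnn N).
elim/ltn_ind: c N Pc P_ex P_dec => c IH N Pc P_ex P_dec.
have [all_c|] := pselect (forall n, (N <= n)%N -> P n c).
  by exists c, N.
move=> /existsNP[n /not_implyP[Nn nPc]].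
have le_c k c' : P (N + k)%N c' -> (c' <= c)%N.
  elim: k c' => [|k IHk] c'; first by rewrite addn0 => /(P_uniq _ _ _ Pc) ->.
  have [d Pd] := P_ex (N + k)%N (leq_addr _ _).
  by rewrite addnS => /(P_dec _ _ _ (leq_addr _ _) Pd) /leq_trans; apply; exact: IHk.
have [c' Pc'] := P_ex n Nn.
have c'c : (c' < c)%N.
  rewrite ltn_neqAle (le_c (n - N)%N) ?subnKC // andbT.
  by apply: contra_notN nPc => /eqP <-.
have [| |e [M [nM PM]]] := IH c' c'c n Pc'.
- by move=> k nk; apply: P_ex; exact: leq_trans nk.
- by move=> k d d' nk; apply: P_dec; exact: leq_trans nk.
by exists e, M; split=> //; exact: leq_trans nM.
Qed.

End ZeroCocycles.

(** * Stabilization *)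

Section Main.
Variables (R : rcfType) (d : nat) (a : 'I_d.+1 -> R).
Let f : Lambda R := \sum_(i < d.+1) a i *: sigma R i.
Let I := ideal_gen [:: f].
Let p : {poly R} := \poly_(i < d.+1) a (inord i).

Lemma zero_set_cuts n : cuts (zeros p) (V n I).
Proof.
move=> x; rewrite /= V_ideal_gen /zeros.
have phiE : phi f n = \sum_(i < d.+1) a i *: mesym n R i.
  exact: (big_morph (fun g : Lambda R => phi g n) (fun _ _ => erefl) erefl).
have -> : symlin p (coords x) = (phi f n).@[x 0].
  rewrite -(symlin_mesym _ (size_poly _ _)) phiE raddf_sum; apply: eq_bigr => i _.
  by rewrite /= mevalZ coef_poly ltn_ord inord_val.
split=> [fx|/eqP fx g]; first by apply/eqP/fx; rewrite mem_head.
by rewrite inE => /eqP ->.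
Qed.

Lemma cohomology0_stable : exists c N : nat, forall n, (N <= n)%N ->
  has_dim (cohomology (V n I) 0) c /\
  forall s (h : cohomology (V n I) 0), snm_act s h = h.
Proof.
pose P n c := has_dim (cocycles (V n I) 0) c.
have P_uniq n c c' : P n c -> P n c' -> c = c'.
  move=> Pc Pc'; apply/eqP; rewrite eqn_leq.
  have idl : linear (@id (cocycles (V n I) 0)) by [].
  by rewrite (has_dim_leq idl (@inj_id _) Pc Pc') (has_dim_leq idl (@inj_id _) Pc' Pc).
have p0 s : zeros p (0 :: s) = zeros p s by rewrite /zeros /= mul0r addr0.
have [||c [M [pM cM]]] := @nonincreasing_eventually_constant P (size p).+1 _ _ P_uniq.
- move=> n pn; apply: (cocycles_has_dim (zero_set_cuts (n := n))).
  exact: tame_zeros_poly.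
- move=> n c c' pn Pc Pc'; pose SP := zero_set_cuts (n := n); pose SP' := zero_set_cuts (n := n.+1).
  apply: has_dim_leq (pull_cocycle_linear SP SP' p0) _ Pc' Pc.
  by apply: pull_cocycle_inj; apply: tame_zeros_poly; exact: leqW.
exists c, M => n Mn; split.
  exact: has_dim_bij (@class0_linear _ _ _) (@class0_bijective _ _ _) (cM n Mn).
apply: cohomology0_trivial => s v; apply: (cocycles_trivial (zero_set_cuts (n := n))).
by apply: tame_zeros_poly; exact: leq_trans Mn.
Qed.

End Main.

Theorem theorem5 (R : rcfType) (d : nat) (a : 'I_d.+1 -> R)
    (lambda : seq nat) (lambda_part : is_partition lambda) :
  let f : Lambda R := \sum_(i < d.+1) a i *: sigma R i in
  let I := ideal_gen [:: f] in
  ((0 < size lambda)%N ->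
     exists N : nat, forall (n : nat) (n_gt0 : (0 < n)%N)
       (n_ge : (head 0 lambda + sumn lambda <= n)%N), (N <= n)%N ->
     is_multiplicity (cohomology (V n I) 0) (pad lambda_part n_gt0 n_ge) 0) /\
  (size lambda = 0%N ->
     exists c N : nat, forall (n : nat) (n_gt0 : (0 < n)%N)
       (n_ge : (head 0 lambda + sumn lambda <= n)%N), (N <= n)%N ->
     is_multiplicity (cohomology (V n I) 0) (pad lambda_part n_gt0 n_ge) c).
Proof.
move=> f I; have [c [N stable]] := cohomology0_stable a.
split=> [lambda_gt0|lambda0].
  exists N => n n_gt0 n_ge /stable[dimc triv].
  have := trivial_multiplicity n_gt0 (pad lambda_part n_gt0 n_ge) triv dimc.
  by rewrite /= /pad_seq eqseq_cons -size_eq0 (gtn_eqF lambda_gt0) andbF.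
exists c, N => n n_gt0 n_ge /stable[dimc triv].
have := trivial_multiplicity n_gt0 (pad lambda_part n_gt0 n_ge) triv dimc.
have padE : pad_seq lambda n = [:: n] by rewrite /pad_seq (size0nil lambda0) subn0.
by rewrite -[val _]/(pad_seq lambda n) padE eqxx.
Qed.
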